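(* Let $(A,\Pi)$ be a Lie algebroid over $M$ with a Nambu structure $\Pi$ of order $n$. If the modular class of $(A,\Pi)$ is zero, then there exists a (nowhere vanishing) density of $A$ invariant under all Hamiltonian $A$-sections. The converse is true if $\Gamma A^*$ is locally generated by elements of the form $d_Af$, $f\in C^\infty(M)$.
   Context: $\rho$ is the anchor of $A$, $d_A$ the Lie algebroid differential. For $X\in\Gamma A$: $\mathcal L_X=\iota_Xd_A+d_A\iota_X$ on forms; $\mathcal L_XP=[X,P]$ (Schouten bracket) on multisections. Contractions: multisections are evaluated by $P(\alpha_1\wedge\cdots\wedge\alpha_k)=P(\alpha_1,\dots,\alpha_k)$, with $(X_1\wedge\cdots\wedge X_k)(\alpha_1,\dots,\alpha_k)=\det(\alpha_i(X_j))$; for $\alpha\in\Gamma A^*$, $(\iota_\alpha P)(\beta)=P(\alpha\wedge\beta)$ and $\iota_{\alpha_1\wedge\cdots\wedge\alpha_k}=\iota_{\alpha_k}\circ\cdots\circ\iota_{\alpha_1}$, extended linearly. $\Pi^\sharp\alpha=\iota_\alpha\Pi$. Nambu structure of order $n$ ($3\le n\le\operatorname{rank}A$): $\Pi\in\Gamma(\wedge^nA)$ with $\mathcal L_{\Pi^\sharp\alpha}\Pi=(-1)^n(\iota_{d_A\alpha}\Pi)\Pi$ for all $\alpha\in\Gamma(\wedge^{n-1}A^* )$. The Hamiltonian $A$-section of $f_1,\dots,f_{n-1}\in C^\infty(M)$ is $\Pi^\sharp(d_Af_1\wedge\cdots\wedge d_Af_{n-1})$. Densities: a density of $A$ is a nowhere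 vanishing section $\mu$ of $\wedge^{\mathrm{top}}A^*\otimes\mathcal O$, where $\mathcal O$ is the (flat) orientation line bundle of $A$; if $A$ is oriented this is just a nowhere vanishing $\mu\in\Gamma(\wedge^{\mathrm{top}}A^* )$. The Lie derivative $\mathcal L_X$ extends to such sections using local locally-constant trivializations of $\mathcal O$. $\mu$ is invariant under $X\in\Gamma A$ if $\mathcal L_X\mu=0$. Modular class: the modular tensor field $M^\mu\in\Gamma(\wedge^{n-1}A)$ of $\mu$ is defined by $(\iota_\alpha M^\mu)\mu=\mathcal L_{\Pi^\sharp\alpha}\mu+(-1)^n(\iota_{d_A\alpha}\Pi)\mu$ for all $\alpha\in\Gamma(\wedge^{n-1}A^* )$. The Leibniz algebra $\mathcal A=\Gamma(\wedge^{n-1}A^* )$ has bracket $[\alpha,\beta]=\mathcal L_{\Pi^\sharp\alpha}\beta+(-1)^n(\iota_{d_A\alpha}\Pi)\beta$ and acts on $C^\infty(M)$ by $\alpha\cdot f=\rho(\Pi^\sharp\alpha)(f)$. $\mathcal H^1_{Leib}(\mathcal A)$ is the space of $\mathbb R$-linear maps $c:\mathcal A\to C^\infty(M)$ with $\rho(\Pi^\sharp\alpha)(c(\beta))-\rho(\Pi^\sharp\beta)(c(\alpha))=c([\alpha,\beta])$ modulo the coboundaries $\alpha\mapsto\rho(\Pi^\sharp\alpha)(f)$, $f\in C^\infty(M)$. The map $\alpha\mapsto\iota_\alpha M^\mu$ is a $1$-cocycle whose class is independent of $\mu$; this class is the modular class of $(A,\Pi)$. *)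

(* Defs.v *)
From HB Require Import structures.
From mathcomp Require Import all_boot all_order all_algebra.
From mathcomp Require Import all_classical all_reals all_analysis.

Set Implicit Arguments.
Unset Strict Implicit.
Unset Printing Implicit Defensive.

Import Order.TTheory GRing.Theory Num.Theory.
Import numFieldNormedType.Exports.

Local Open Scope classical_set_scope.
Local Open Scope ring_scope.

Fixpoint Ck (R : realType) (d k : nat) (U : set 'rV[R]_d) (f : 'rV[R]_d -> R) :
    Prop :=
  (forall x, U x -> {for x, continuous f}) /\
  match k with
  | 0 => True
  | k'.+1 => forall i : 'I_d,
      (forall x, U x -> derivable f x (delta_mx 0 i)) /\
      Ck k' U ('D_(delta_mx 0 i) f)
  end.

(* Meant for [U] open. *)
Definition Cinfty (R : realType) (d : nat) (U : set 'rV[R]_d)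
    (f : 'rV[R]_d -> R) := forall k, Ck k U f.

(* A homeomorphism [cmap] from the open set [cdom] onto the open set [cimg],
   with inverse [cinv]; the values of [cmap] off [cdom] and of [cinv] off
   [cimg] are irrelevant. *)
Record chart (R : realType) (d : nat) (M : topologicalType) := Chart {
  cdom : set M;
  cimg : set 'rV[R]_d;
  cmap : M -> 'rV[R]_d;
  cinv : 'rV[R]_d -> M;
  cdom_open : open cdom;
  cimg_open : open cimg;
  cmap_img : forall x, cdom x -> cimg (cmap x);
  cinv_dom : forall y, cimg y -> cdom (cinv y);
  cmapK : forall x, cdom x -> cinv (cmap x) = x;
  cinvK : forall y, cimg y -> cmap (cinv y) = y;
  cmap_continuous : forall x, cdom x -> {for x, continuous cmap};
  cinv_continuous : forall y, cimg y -> {for y, continuous cinv} }.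

Record manifold (R : realType) (d : nat) := Manifold {
  mspace :> topologicalType;
  atlas : set (chart R d mspace);
  mspace_hausdorff : hausdorff_space mspace;
  mspace_second_countable : @second_countable mspace;
  atlas_cover : forall x : mspace, exists2 c, atlas c & cdom c x;
  atlas_compat : forall c c', atlas c -> atlas c' -> forall i : 'I_d,
    Cinfty (cimg c `&` cinv c @^-1` cdom c')
           (fun y => cmap c' (cinv c y) 0 i) }.

Section SmoothFunctions.
Context {R : realType} {d : nat} {M : manifold R d}.

(* Meant for [U] open in [M]. *)
Definition smooth_on (U : set M) (f : M -> R) :=
  forall c, atlas c -> Cinfty (cimg c `&` cinv c @^-1` U) (f \o cinv c).

Definition smooth (f : M -> R) := smooth_on setT f.

Definition smooth_near (x : M) (f : M -> R) :=
  exists U : set M, [/\ open U, U x & smooth_on U f].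

(* The elements of T_xM: the combinations of the coordinate vectors at [x],
   acting on the functions that are smooth near [x]. *)
Definition tangent (x : M) (D : (M -> R) -> R) :=
  exists c, [/\ atlas c, cdom c x &
    exists a : 'I_d -> R, forall f, smooth_near x f ->
      D f = \sum_(i < d) a i * 'D_(delta_mx 0 i) (f \o cinv c) (cmap c x)].

End SmoothFunctions.

Record local_frame (R : realType) (d r : nat) (M : manifold R d)
    (fib : M -> vectType R) := LocalFrame {
  fdom : set M;
  fbasis :> forall x, r.-tuple (fib x) }.

(* A vector bundle of rank [r] over [M]: a family of vector spaces with an
   atlas of local trivializations, each given by the frame it induces, whose
   transition matrices are smooth. *)
Record vector_bundle (R : realType) (d : nat) (M : manifold R d) (r : nat) :=
  VectorBundle {
  fib :> M -> vectType R;
  frames : set (local_frame r fib);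
  frame_open : forall e, frames e -> open (fdom e);
  frame_basis : forall e x, frames e -> fdom e x ->
    basis_of {: fib x} (e x);
  frame_cover : forall x, exists2 e, frames e & fdom e x;
  frame_compat : forall e e', frames e -> frames e' -> forall i j : 'I_r,
    smooth_on (fdom e `&` fdom e')
              (fun x => coord (e x) i (tnth (e' x) j)) }.

Section Sections.
Context {R : realType} {d : nat} {M : manifold R d} {r : nat}.
Variable A : vector_bundle M r.

Definition sect := forall x : M, A x.

Definition smooth_sect (X : sect) :=
  forall e, frames e -> forall i : 'I_r,
    smooth_on (fdom e) (fun x => coord (e x) i (X x)).

End Sections.

(* [bracket] is only meaningful on smooth sections, and [anchor x v f] (the
   derivative of [f] at [x] along rho(v)) on functions smooth near [x]. *)
Record lie_algebroid (R : realType) (d : nat) (M : manifold R d) (r : nat) :=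
  LieAlgebroid {
  bundle :> vector_bundle M r;
  anchor : forall x : M, bundle x -> (M -> R) -> R;
  bracket : sect bundle -> sect bundle -> sect bundle;
  anchor_tangent : forall x v, tangent x (@anchor x v);
  anchor_linear : forall x a u v f, smooth_near x f ->
    @anchor x (a *: u + v) f = a * @anchor x u f + @anchor x v f;
  anchor_smooth : forall X f, smooth_sect X -> smooth f ->
    smooth (fun x => anchor (X x) f);
  bracket_smooth : forall X Y, smooth_sect X -> smooth_sect Y ->
    smooth_sect (bracket X Y);
  bracket_linear : forall a X Y Z, smooth_sect X -> smooth_sect Y ->
    smooth_sect Z -> forall x,
    bracket (fun y => a *: X y + Y y) Z x = a *: bracket X Z x + bracket Y Z x;
  bracket_antisym : forall X Y, smooth_sect X -> smooth_sect Y ->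
    forall x, bracket X Y x = - bracket Y X x;
  bracket_jacobi : forall X Y Z, smooth_sect X -> smooth_sect Y ->
    smooth_sect Z -> forall x,
    bracket X (bracket Y Z) x + bracket Y (bracket Z X) x
      + bracket Z (bracket X Y) x = 0;
  bracket_leibniz : forall X Y f, smooth_sect X -> smooth_sect Y -> smooth f ->
    forall x, bracket X (fun y => f y *: Y y) x
              = f x *: bracket X Y x + anchor (X x) f *: Y x;
  anchor_bracket : forall X Y f, smooth_sect X -> smooth_sect Y -> smooth f ->
    forall x, anchor (bracket X Y x) f
              = anchor (X x) (fun y => anchor (Y y) f)
                - anchor (Y x) (fun y => anchor (X y) f) }.

Definition upd (k : nat) (T : Type) (v : 'I_k -> T) (i : 'I_k) (u : T) :
    'I_k -> T := fun j => if j == i then u else v j.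

Definition vcons (k : nat) (T : Type) (u : T) (v : 'I_k -> T) : 'I_k.+1 -> T :=
  fun i => if unlift ord0 i is Some j then v j else u.

Definition vrcons (k : nat) (T : Type) (v : 'I_k -> T) (u : T) : 'I_k.+1 -> T :=
  fun i => if unlift ord_max i is Some j then v j else u.

Section Multilinear.
Context {R : realType}.

Definition alternating (V : lmodType R) (k : nat) (f : ('I_k -> V) -> R) :=
  (forall v i a u w,
    f (upd v i (a *: u + w)) = a * f (upd v i u) + f (upd v i w)) /\
  (forall v i j, i != j -> v i = v j -> f v = 0).

Variable V : vectType R.

Definition dual := 'Hom(V, R^o).

Definition base (i : 'I_(\dim {: V})) : V := tnth (vbasis {: V}) i.

Definition cobase (i : 'I_(\dim {: V})) : dual :=
  linfun (coord (vbasis {: V}) i : V -> R^o).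

Definition increasing (p q : nat) (I : {ffun 'I_p -> 'I_q}) :=
  [forall i : 'I_p, forall j : 'I_p, (i < j)%N ==> (I i < I j)%N].

(* The elements of Lambda^k V are the alternating functions of k covectors.
   [contract] and [sharp] give iota_alpha P, for alpha of degree k and P of
   degree k, resp. k.+1: they expand
   alpha = \sum_I alpha(e_I) e^(I 1) /\ ... /\ e^(I k), over the increasing I,
   and use iota_(a_1 /\ ... /\ a_k) P = P(a_1, ..., a_k, -).  In [sharp] the
   result, an element of V^** = V, is expanded in the basis e. *)
Definition contract (k : nat) (alpha : ('I_k -> V) -> R)
    (P : ('I_k -> dual) -> R) : R :=
  \sum_(I : {ffun 'I_k -> 'I_(\dim {: V})} | increasing I)
    alpha (fun l => base (I l)) * P (fun l => cobase (I l)).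

Definition sharp (k : nat) (alpha : ('I_k -> V) -> R)
    (P : ('I_k.+1 -> dual) -> R) : V :=
  \sum_(I : {ffun 'I_k -> 'I_(\dim {: V})} | increasing I) \sum_j
    (alpha (fun l => base (I l)) * P (vrcons (fun l => cobase (I l)) (cobase j)))
      *: base j.

(* (v_1 /\ ... /\ v_k)(xi_1, ..., xi_k) *)
Definition decomposable (k : nat) (v : 'I_k -> V) (xi : 'I_k -> dual) : R :=
  \det (\matrix_(i < k, j < k) (xi i (v j) : R)).

End Multilinear.

Section Calculus.
Context {R : realType} {d : nat} {M : manifold R d} {r : nat}.
Variable A : lie_algebroid M r.

Definition form_field (k : nat) := forall x : M, ('I_k -> A x) -> R.

Definition is_form (k : nat) (alpha : form_field k) :=
  (forall x, alternating (alpha x)) /\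
  (forall X : 'I_k -> sect A, (forall i, smooth_sect (X i)) ->
    smooth (fun x => alpha x (fun i => X i x))).

Definition smooth_cosect (xi : forall x : M, dual (A x)) :=
  forall X : sect A, smooth_sect X -> smooth (fun x => xi x (X x)).

Definition multi_field (k : nat) := forall x : M, ('I_k -> dual (A x)) -> R.

Definition is_multisection (k : nat) (P : multi_field k) :=
  (forall x, alternating (P x)) /\
  (forall xi : 'I_k -> forall x : M, dual (A x),
    (forall i, smooth_cosect (xi i)) -> smooth (fun x => P x (fun i => xi i x))).

(* A smooth section through a given point of the total space. *)
Definition ext (x : M) (v : A x) : sect A :=
  xget (fun y => 0) [set X : sect A | smooth_sect X /\ X x = v].

(* The Koszul formula
     (d alpha)(X_0, ..., X_k) = \sum_i (-1)^i rho(X_i) alpha(.., ^X_i, ..)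
       + \sum_(i < j) (-1)^(i+j) alpha([X_i, X_j], .., ^X_i, .., ^X_j, ..),
   where [X_i, X_j] has been moved to the place of X_j, which turns the second
   sign into - (-1)^i.  It is tensorial, so the value at [x] may be computed
   with any sections extending the given vectors; it only involves [alpha] near
   [x], so it also applies to forms which are only smooth near [x]. *)
Definition dA (k : nat) (alpha : form_field k) : form_field k.+1 :=
  fun x v =>
    let X i := ext (v i) in
    \sum_(i < k.+1) (-1) ^+ i *
      (anchor (v i) (fun y => alpha y (fun l => X (lift i l) y))
       - \sum_(j < k | (i < lift i j)%N)
           alpha x (upd (fun l => v (lift i l)) j
                        (bracket (X i) (X (lift i j)) x))).
Arguments dA {k} alpha x v.

Definition fun_form (f : M -> R) : form_field 0 := fun x _ => f x.
Arguments fun_form : clear implicits.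

Definition dfun (f : M -> R) : form_field 1 := dA (fun_form f).
Arguments dfun : clear implicits.

Definition wedge1 (k : nat) (xi : 'I_k -> form_field 1) : form_field k :=
  fun x v => \det (\matrix_(i < k, j < k) xi i x (fun=> v j)).
Arguments wedge1 {k} xi x v.

Definition iota (X : sect A) (k : nat) (alpha : form_field k.+1) :
    form_field k := fun x v => alpha x (vcons (X x) v).
Arguments iota X {k} alpha x v.

Definition lie (X : sect A) (k : nat) : form_field k -> form_field k :=
  match k with
  | 0 => fun alpha => iota X (dA alpha)
  | k'.+1 => fun alpha x v => iota X (dA alpha) x v + dA (iota X alpha) x v
  end.
Arguments lie X {k} alpha x v.

(* [Q] is the Schouten bracket [X, P]: near each point, writing
   P = \sum_a g_a Y_a1 /\ ... /\ Y_ak, one has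
   Q = \sum_a (rho(X)(g_a) Y_a1 /\ ... /\ Y_ak
               + g_a \sum_l Y_a1 /\ ... /\ [X, Y_al] /\ ... /\ Y_ak). *)
Definition is_schouten (X : sect A) (k : nat) (P Q : multi_field k) :=
  forall x : M, exists U : set M, [/\ open U, U x &
    exists (s : nat) (g : 'I_s -> M -> R) (Y : 'I_s -> 'I_k -> sect A),
    [/\ forall a, smooth (g a),
        forall a l, smooth_sect (Y a l) &
        forall y, U y -> forall xi : 'I_k -> dual (A y),
          P y xi = \sum_a g a y * decomposable (fun l => Y a l y) xi /\
          Q y xi = \sum_a
            (anchor (X y) (g a) * decomposable (fun l => Y a l y) xi
             + g a y * \sum_(l < k) decomposable
                 (upd (fun l' => Y a l' y) l (bracket X (Y a l) y)) xi)]].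

Section Nambu.
Variable m : nat.

Definition sharp_sect (Pi : multi_field m.+1) (alpha : form_field m) : sect A :=
  fun x => sharp (alpha x) (Pi x).
Arguments sharp_sect : clear implicits.

(* (-1)^n iota_(d_A alpha) Pi, with n = m.+1 *)
Definition nambu_div (Pi : multi_field m.+1) (alpha : form_field m) : M -> R :=
  fun x => (-1) ^+ m.+1 * contract (dA alpha x) (Pi x).

(* Nambu structures of order m.+1; the equation is [Pi^# alpha, Pi] = ... *)
Definition is_nambu (Pi : multi_field m.+1) :=
  is_multisection Pi /\
  forall alpha, is_form alpha ->
    is_schouten (sharp_sect Pi alpha) Pi
                (fun x xi => nambu_div Pi alpha x * Pi x xi).

Definition hamiltonian (Pi : multi_field m.+1) (f : 'I_m -> M -> R) : sect A :=
  sharp_sect Pi (wedge1 (fun i => dfun (f i))).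
Arguments hamiltonian : clear implicits.

End Nambu.

(* The fibre at [x] of Lambda^top A^* (x) O is the space of the maps from the
   bases of A_x to the r-forms on A_x which only depend on the orientation of
   the basis and change sign with it. *)
Definition density_field :=
  forall x : M, r.-tuple (A x) -> ('I_r -> A x) -> R.

(* Locally, a frame [e] trivializes O; this is the corresponding r-form. *)
Definition trivialized (mu : density_field) (e : local_frame r A) :
    form_field r := fun x => mu x (e x).
Arguments trivialized : clear implicits.

Definition is_density (mu : density_field) :=
  [/\ forall x (b : r.-tuple (A x)), basis_of {: A x} b -> alternating (mu x b),
      forall x (b b' : r.-tuple (A x)),
        basis_of {: A x} b -> basis_of {: A x} b' ->
        forall v, mu x b' v =
          Num.sg (\det (\matrix_(i < r, j < r) coord b i (tnth b' j)))
          * mu x b v,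
      forall e, frames e -> forall X : 'I_r -> sect A,
        (forall i, smooth_sect (X i)) ->
        smooth_on (fdom e) (fun x => trivialized mu e x (fun i => X i x)) &
      forall x (b : r.-tuple (A x)), basis_of {: A x} b -> exists v, mu x b v != 0].

(* L_X mu = 0, computed in the local flat trivializations of O. *)
Definition invariant (X : sect A) (mu : density_field) :=
  forall e, frames e -> forall x, fdom e x ->
    forall v, lie X (trivialized mu e) x v = 0.

Section ModularClass.
Variables (m : nat) (Pi : multi_field m.+1).

Definition is_modular_tensor (mu : density_field) (T : multi_field m) :=
  is_multisection T /\
  forall alpha, is_form alpha -> forall e, frames e -> forall x, fdom e x ->
    forall v, contract (alpha x) (T x) * trivialized mu e x v
      = lie (sharp_sect Pi alpha) (trivialized mu e) x v
        + nambu_div Pi alpha x * trivialized mu e x v.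

Definition leib_bracket (alpha beta : form_field m) : form_field m :=
  fun x v => lie (sharp_sect Pi alpha) beta x v + nambu_div Pi alpha x * beta x v.
Arguments leib_bracket : clear implicits.

Definition leib_action (alpha : form_field m) (f : M -> R) : M -> R :=
  fun x => anchor (sharp_sect Pi alpha x) f.

(* Only the values on smooth forms matter. *)
Definition cochain := form_field m -> M -> R.

Definition is_cocycle (c : cochain) :=
  [/\ forall alpha, is_form alpha -> smooth (c alpha),
      forall a alpha beta, is_form alpha -> is_form beta -> forall x,
        c (fun y v => a * alpha y v + beta y v) x = a * c alpha x + c beta x &
      forall alpha beta, is_form alpha -> is_form beta -> forall x,
        leib_action alpha (c beta) x - leib_action beta (c alpha) x
        = c (leib_bracket alpha beta) x].

Definition cohomologous (c c' : cochain) :=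
  exists2 f, smooth f & forall alpha, is_form alpha -> forall x,
    c alpha x - c' alpha x = leib_action alpha f x.

(* The element of H^1_Leib defined by [c], as a coset of the coboundaries. *)
Definition leib_class (c : cochain) : set cochain :=
  [set c' | is_cocycle c' /\ cohomologous c' c].

Definition tensor_cochain (T : multi_field m) : cochain :=
  fun alpha x => contract (alpha x) (T x).

(* As the class of the cocycle given by M^mu does not depend on mu, this union
   is a single class. *)
Definition modular_class : set cochain :=
  [set c | exists mu T, [/\ is_density mu, is_modular_tensor mu T &
                            leib_class (tensor_cochain T) c]].

Definition modular_class_zero := modular_class = leib_class (fun _ _ => 0).

End ModularClass.

Definition locally_generated_by_differentials :=
  forall x : M, exists U : set M, [/\ open U, U x &
    forall xi : form_field 1, is_form xi ->
    exists (s : nat) (g f : 'I_s -> M -> R),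
    [/\ forall j, smooth_on U (g j), forall j, smooth (f j) &
        forall y, U y -> forall v,
          xi y v = \sum_(j < s) g j y * dfun (f j) y v]].

Definition hamiltonian_invariant (m : nat) (Pi : multi_field m.+1)
    (mu : density_field) :=
  forall f : 'I_m -> M -> R, (forall i, smooth (f i)) ->
    invariant (hamiltonian Pi f) mu.

End Calculus.

(* Main.v *)
(** By Cartan's formula [L_X = i_X d + d i_X] one has, for a top form (or a
    density) [mu], [L_X (g mu) = g L_X mu + X(g) mu] and, because
    [dg /\ mu = 0], [L_(g X) mu = g L_X mu + X(g) mu].

    If [i_alpha M^mu = - X_alpha(f)] for all [alpha], where
    [X_alpha = Pi^# alpha], then [exp(f) mu] is invariant under the
    Hamiltonian sections, since [d(df_1 /\ ... /\ df_m) = 0].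

    Conversely, the identity
    [(-1)^n i_(dg /\ alpha) Pi = - X_alpha(g)] makes
    [alpha |-> L_(X_alpha) mu + (-1)^n (i_(d alpha) Pi) mu] linear over the
    smooth functions.  For an invariant [mu] it vanishes on products of exact
    1-forms, hence everywhere when these generate locally, so that
    [M^mu = 0].  Another density is [h mu] with [h] nowhere zero, and the two
    modular tensors differ by the coboundary of [ln |h|].

    The Koszul formula defining [d] is evaluated on arbitrary smooth sections
    extending the given vectors; its independence of the extensions is proved
    with bump functions, built from [exp(-1/t)] in a chart. *)

Require Import Defs.
From HB Require Import structures.
From mathcomp Require Import all_boot all_order all_algebra all_fingroup.
From mathcomp Require Import all_classical all_reals all_analysis.
From mathcomp Require Import ring.

Import Defs.

Set Implicit Arguments.
Unset Strict Implicit.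
Unset Printing Implicit Defensive.

Import Order.TTheory GRing.Theory Num.Theory.
Import numFieldNormedType.Exports.

Local Open Scope classical_set_scope.
Local Open Scope ring_scope.

(** * Alternating functions *)

(** Two features of the definitions shape the proof. [contract] and [sharp] expand in [vbasis],
    which has no reason to vary smoothly with the point, and they sum over increasing multi-indices,
    a range not preserved by a change of basis. Multiplying by [k!] turns these sums into sums over
    all multi-indices, which any basis computes, in particular that of a local frame. Moreover
    brackets, smooth forms and smooth multisections may only be evaluated on global sections. Frames
    and coframes are therefore cut off by a function [b] equal to 1 at the point under study, and
    every identity carries a power of [b] that counts the cut-off arguments. A trivialized density,
    on the other hand, is a form over the domain of its frame only, so the calculus is developed for
    forms over an open set.

    The vanishing of the modular class is an equality of sets of cochains. Read from right to left
    it produces a density together with a primitive; to establish it, every density has to be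
    compared with the invariant one. *)

Section Updates.
Context {k : nat} {T : Type}.
Implicit Type v : 'I_k -> T.

Lemma upd_at v i u : upd v i u i = u.
Proof. by rewrite /upd eqxx. Qed.

Lemma upd_off v i u j : j != i -> upd v i u j = v j.
Proof. by rewrite /upd => /negPf ->. Qed.

Lemma upd_id v i : upd v i (v i) = v.
Proof. by apply/funext => j; rewrite /upd; case: eqP => // ->. Qed.

Lemma upd_upd v i u w : upd (upd v i u) i w = upd v i w.
Proof. by apply/funext => j; rewrite /upd; case: eqP. Qed.

Lemma upd_comm v i j u w : i != j ->
  upd (upd v i u) j w = upd (upd v j w) i u.
Proof.
move=> ij; apply/funext => l; rewrite /upd.
by case: (l =P j) => // ->; rewrite eq_sym (negPf ij).
Qed.

End Updates.

Lemma map_upd k T S (h : T -> S) (v : 'I_k -> T) i u :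
  (fun l => h (upd v i u l)) = upd (fun l => h (v l)) i (h u).
Proof. by apply/funext => l; rewrite /upd; case: eqP. Qed.

Lemma upd_lift_at k T (v : 'I_k.+1 -> T) i u :
  (fun l => upd v i u (lift i l)) = (fun l => v (lift i l)).
Proof. by apply/funext => l; rewrite upd_off // eq_sym neq_lift. Qed.

Lemma upd_lift k T (v : 'I_k.+1 -> T) i j u :
  (fun l => upd v (lift i j) u (lift i l)) = upd (fun l => v (lift i l)) j u.
Proof. by apply/funext => l; rewrite /upd (inj_eq (@lift_inj _ i)). Qed.

(** [vcons] and [vrcons] are, up to conversion, the cases [ord0] and [ord_max], so each fact about
    [insert] serves both. *)
Definition insert k T (i : 'I_k.+1) (u : T) (v : 'I_k -> T) : 'I_k.+1 -> T :=
  fun l => if unlift i l is Some j then v j else u.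

Section Insert.
Context {k : nat} {T : Type}.
Implicit Types (i : 'I_k.+1) (v : 'I_k -> T).

Lemma insert_at i u v : insert i u v i = u.
Proof. by rewrite /insert unlift_none. Qed.

Lemma insert_lift i u v j : insert i u v (lift i j) = v j.
Proof. by rewrite /insert liftK. Qed.

Lemma insert_id i (w : 'I_k.+1 -> T) :
  insert i (w i) (fun l => w (lift i l)) = w.
Proof.
apply/funext => l; case: (unliftP i l) => [j|] ->; last exact: insert_at.
exact: insert_lift.
Qed.

Lemma insert_upd i u v j w :
  insert i u (upd v j w) = upd (insert i u v) (lift i j) w.
Proof.
apply/funext => l; case: (unliftP i l) => [l'|] ->.
  by rewrite insert_lift /upd (inj_eq (@lift_inj _ i)) insert_lift.
by rewrite insert_at upd_off ?insert_at // neq_lift.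
Qed.

Lemma upd_insert i u v w : upd (insert i u v) i w = insert i w v.
Proof.
apply/funext => l; case: (unliftP i l) => [l'|] ->.
  by rewrite upd_off ?insert_lift // eq_sym neq_lift.
by rewrite insert_at upd_at.
Qed.

Lemma vcons0 (u : T) v : vcons u v ord0 = u.
Proof. exact: (insert_at ord0). Qed.

Lemma vcons_lift (u : T) v : (fun l => vcons u v (lift ord0 l)) = v.
Proof. by apply/funext => l; exact: (insert_lift ord0). Qed.

End Insert.

Lemma map_insert k T S (h : T -> S) (i : 'I_k.+1) u (v : 'I_k -> T) :
  (fun l => h (insert i u v l)) = insert i (h u) (fun l => h (v l)).
Proof. by apply/funext => l; rewrite /insert; case: (unlift i l). Qed.

Lemma sum_insert (W : nmodType) (T : finType) k (i : 'I_k.+1)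
    (F : ('I_k.+1 -> T) -> W) :
  \sum_(g : {ffun 'I_k.+1 -> T}) F g
  = \sum_a \sum_(h : {ffun 'I_k -> T}) F (insert i a h).
Proof.
rewrite pair_bigA /=.
rewrite (reindex (fun p : T * {ffun 'I_k -> T} => finfun (insert i p.1 p.2))) /=.
  by apply: eq_bigr => p _; congr F; apply/funext => l; rewrite ffunE.
exists (fun g : {ffun 'I_k.+1 -> T} => (g i, [ffun l => g (lift i l)])).
  move=> [a h] _ /=; rewrite ffunE insert_at; congr pair.
  by apply/ffunP => l; rewrite !ffunE insert_lift.
move=> g _ /=; apply/ffunP => l; rewrite ffunE.
rewrite -[RHS](congr1 (@^~ l) (insert_id i g)) /insert.
by case: (unlift i l) => // j; rewrite ffunE.
Qed.

Section Multilinear.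
Context {R : realType}.

Definition multilinear (V : lmodType R) k (f : ('I_k -> V) -> R) :=
  forall v i a u w,
    f (upd v i (a *: u + w)) = a * f (upd v i u) + f (upd v i w).

Section Theory.
Context {V : lmodType R} {k : nat} {f : ('I_k -> V) -> R}.
Hypothesis fL : multilinear f.

Lemma multilin0 v i : f (upd v i 0) = 0.
Proof.
have := fL v i 1 0 0; rewrite scale1r addr0 mul1r => /eqP.
by rewrite -subr_eq subrr eq_sym => /eqP.
Qed.

Lemma multilinD v i u w : f (upd v i (u + w)) = f (upd v i u) + f (upd v i w).
Proof. by rewrite -[u in LHS]scale1r fL mul1r. Qed.

Lemma multilinZ v i a u : f (upd v i (a *: u)) = a * f (upd v i u).
Proof. by rewrite -[_ *: _]addr0 fL multilin0 addr0. Qed.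

Lemma multilin_sum (I : Type) (s : seq I) (P : pred I) (F : I -> V) v i :
  f (upd v i (\sum_(j <- s | P j) F j)) = \sum_(j <- s | P j) f (upd v i (F j)).
Proof.
by apply: (big_morph (fun u => f (upd v i u))); [exact: multilinD|exact: multilin0].
Qed.

End Theory.

Lemma multilin_insert (V : lmodType R) k (f : ('I_k.+1 -> V) -> R) i u :
  multilinear f -> multilinear (fun v => f (insert i u v)).
Proof. by move=> fL v j a w w'; rewrite !insert_upd fL. Qed.

Lemma multilin_expand (V : lmodType R) k n (f : ('I_k -> V) -> R)
    (c : 'I_k -> 'I_n -> R) (e : 'I_n -> V) : multilinear f ->
  f (fun j => \sum_a c j a *: e a)
  = \sum_(g : {ffun 'I_k -> 'I_n}) (\prod_j c j (g j)) * f (fun j => e (g j)).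
Proof.
elim: k f c => [|k IHk] f c fL.
  rewrite (big_pred1 (finfun (fun i : 'I_0 => False_rect 'I_n (notF (ltn_ord i))))).
    by rewrite big_ord0 mul1r; congr f; apply/funext => -[].
  by move=> g; apply/esym/eqP/ffunP => -[].
rewrite (sum_insert ord0 (fun g => (\prod_j c j (g j)) * f (fun j => e (g j)))).
rewrite -(insert_id ord0 (fun j => \sum_a c j a *: e a)).
rewrite (IHk _ (fun j => c (lift ord0 j)) (multilin_insert _ _ fL)).
rewrite [RHS]exchange_big /=; apply: eq_bigr => h _.
rewrite -(upd_insert _ 0) (multilin_sum fL) big_distrr /=.
apply: eq_bigr => a _; rewrite (multilinZ fL) upd_insert big_ord_recl.
rewrite insert_at -mulrA mulrCA; congr (_ * _).
rewrite (map_insert e); congr (_ * _).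
by apply: eq_bigr => j _; rewrite insert_lift.
Qed.

Lemma alternating_multilin (V : lmodType R) k (f : ('I_k -> V) -> R) :
  alternating f -> multilinear f.
Proof. by case. Qed.

Section Alternating.
Context {V : lmodType R} {k : nat} {f : ('I_k -> V) -> R}.
Hypothesis fA : alternating f.

(** Polarization: expand the vanishing value of [f] with [v i + v j] in both places. *)
Lemma alt_tperm v i j : i != j -> f (v \o tperm i j) = - f v.
Proof.
move=> ij; have [fL f0] := fA.
have alt0 u : f (upd (upd v i u) j u) = 0.
  by apply: (f0 _ i j) => //; rewrite upd_at upd_off // upd_at.
have := alt0 (v i + v j).
rewrite (multilinD fL) !(upd_comm _ _ _ ij) !(multilinD fL).
rewrite -!(upd_comm _ _ _ ij) !alt0 add0r addr0 upd_id upd_id.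
rewrite addrC (_ : upd _ _ _ = v \o tperm i j).
  by rewrite addrC => /eqP; rewrite addr_eq0 => /eqP.
apply/funext => l /=; rewrite /upd; case: tpermP => [->|->|/eqP li /eqP lj].
- by rewrite (negPf ij) eqxx.
- by rewrite eqxx.
- by rewrite (negPf li) (negPf lj).
Qed.

Lemma alt_perm v (s : 'S_k) : f (v \o s) = (-1) ^+ s * f v.
Proof.
have [ts ->] := prod_tpermP s.
elim: ts v => [|[i j] ts IH] v /=.
  rewrite big_nil odd_perm1 expr0 mul1r => _; congr f.
  by apply/funext => l /=; rewrite perm1.
case/andP; rewrite /dpair /= => ij /IH {}IH.
rewrite big_cons odd_permM odd_tperm ij signr_addb.
have -> : v \o (tperm i j * \prod_(t <- ts) tperm t.1 t.2)%g
    = (v \o (\prod_(t <- ts) tperm t.1 t.2)%g) \o tperm i j.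
  by apply/funext => l /=; rewrite permM.
by rewrite alt_tperm // IH -mulrA mulN1r.
Qed.

End Alternating.

Section AlternatingS.
Context {V : lmodType R} {k : nat}.

(* Moving [v i] to place [j] is the transposition of [i] and [j] seen through
   [lift j] and [lift i], a permutation of sign (-1)^(i+j+1). *)
Lemma alt_lift (f : ('I_k -> V) -> R) (v : 'I_k.+1 -> V) (i j : 'I_k.+1)
    (u : V) :
  alternating f -> i != j ->
  (-1) ^+ i * f (fun l => upd v j u (lift i l))
  + (-1) ^+ j * f (fun l => upd v i u (lift j l)) = 0.
Proof.
move=> fA ij.
pose h l := odflt l (unlift i (tperm i j (lift j l))).
have hK l : lift i (h l) = tperm i j (lift j l).
  rewrite /h; have := neq_lift j l.
  rewrite -(inj_eq (@perm_inj _ (tperm i j))) tpermR => /unlift_some[l' -> ->].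
  by [].
have h_inj : injective h.
  by move=> l l' /(congr1 (lift i)); rewrite !hK => /perm_inj /lift_inj.
have sE : lift_perm j i (perm h_inj) = tperm i j.
  apply/permP => l; case: (unliftP j l) => [l'|] ->.
    by rewrite lift_perm_lift permE hK.
  by rewrite lift_perm_id tpermR.
have := odd_lift_perm j i (perm h_inj); rewrite sE odd_tperm ij => odd_s.
have -> : (fun l => upd v i u (lift j l))
    = (fun l => upd v j u (lift i l)) \o perm h_inj.
  apply/funext => l /=; rewrite permE hK /upd.
  have [->|li] := eqVneq (lift j l) i.
    by rewrite tpermL eqxx.
  have jl := neq_lift j l.
  by rewrite tpermD 1?(eq_sym i) // [lift j l == j]eq_sym (negPf jl).
rewrite alt_perm // mulrA -signr_odd -[in X in _ + X](signr_odd _ j) -signr_addb.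
rewrite (_ : odd j (+) perm h_inj = ~~ odd i).
  by rewrite signrN mulNr subrr.
by move: odd_s; case: (odd i) (odd j) (perm h_inj : bool) => -[] [].
Qed.

(** [lift_perm j i 1] moves the argument [i] to place [j] and keeps the order of the others; it is a
    cycle of sign [(-1)^(i+j)]. *)
Lemma alt_insert (f : ('I_k.+1 -> V) -> R) (v : 'I_k.+1 -> V) (i j : 'I_k.+1) :
  alternating f ->
  f (insert j (v i) (fun l => v (lift i l))) = (-1) ^+ (i + j) * f v.
Proof.
move=> fA.
have -> : insert j (v i) (fun l => v (lift i l)) = v \o lift_perm j i 1%g.
  apply/funext => l /=; case: (unliftP j l) => [l'|] ->.
    by rewrite insert_lift lift_perm_lift perm1.
  by rewrite insert_at lift_perm_id.
rewrite alt_perm // odd_lift_perm odd_perm1 addbF addbC -oddD.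
by rewrite signr_odd.
Qed.

(** The exterior product of a covector and a [k]-form, in the normalization where products of
    covectors are determinants. [xi] is a bare function because it will be [u |-> anchor u g], the
    differential of a function [g] at a point. *)
Definition wedge_covector (xi : V -> R) (f : ('I_k -> V) -> R) :
    ('I_k.+1 -> V) -> R :=
  fun v => \sum_(i < k.+1) (-1) ^+ i * (xi (v i) * f (fun l => v (lift i l))).

Lemma wedge_covector_alt (xi : V -> R) f :
  (forall a u w, xi (a *: u + w) = a * xi u + xi w) ->
  alternating f -> alternating (wedge_covector xi f).
Proof.
move=> xiL fA; have [fL f0] := fA; split.
  move=> v p a u w; rewrite /wedge_covector mulr_sumr -big_split /=.
  apply: eq_bigr => i _; case: (unliftP i p) => [j ->|->].
    rewrite !upd_off ?neq_lift // !upd_lift fL; ring.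
  by rewrite !upd_at !upd_lift_at xiL; ring.
(* Only the summands [p] and [q] avoid a repeated argument of [f]; they cancel by [alt_lift]. *)
move=> v p q pq vpq; rewrite /wedge_covector (bigD1 p) //= (bigD1 q) 1?eq_sym //=.
rewrite big1 ?addr0 => [|i /andP[ip iq]].
  have := alt_lift v (v p) fA pq; rewrite {1}vpq !upd_id -vpq => e.
  by rewrite !mulrA ![_ * xi _]mulrC -!mulrA -mulrDr e mulr0.
have [p' pE] := unlift_some ip; have [q' qE] := unlift_some iq.
rewrite (f0 _ p' q') ?mulr0 //; last by rewrite -pE -qE.
by apply: contraNneq pq => pq'; rewrite pE qE pq'.
Qed.

End AlternatingS.
End Multilinear.

(** * Sums over increasing multi-indices *)

Section IncreasingSums.
Context {k q : nat}.
Implicit Type g : 'I_k -> 'I_q.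

Lemma rank_subproof g (l : 'I_k) : (#|[pred l' | (g l' < g l)%N]| < k)%N.
Proof.
rewrite -[X in (_ < X)%N](card_ord k); apply: proper_card.
by apply/properP; split; [apply/fintype.subsetP|exists l; rewrite ?inE ?ltnn].
Qed.

Definition rank g l : 'I_k := Ordinal (rank_subproof g l).

Lemma leq_rank g (l l' : 'I_k) : (g l <= g l')%N -> (rank g l <= rank g l')%N.
Proof.
move=> le; apply: subset_leq_card; apply/fintype.subsetP => a.
by rewrite !inE => /leq_trans; apply.
Qed.

Lemma ltn_rank g l l' : (g l < g l')%N -> (rank g l < rank g l')%N.
Proof.
move=> lt; apply: proper_card; apply/properP; split.
  by apply/fintype.subsetP => a; rewrite !inE => /ltn_trans; apply.
by exists l; rewrite !inE ?ltnn.
Qed.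

Lemma rank_inj g : injective g -> injective (rank g).
Proof.
move=> g_inj l l' e; apply/g_inj/val_inj/eqP; rewrite /= eqn_leq.
by apply/andP; split; rewrite leqNgt; apply/negP => /ltn_rank; rewrite e ltnn.
Qed.

(** For injective [g] this is the permutation whose inverse rearranges [g] increasingly. The default
    [1] is only met when [g] repeats a value. *)
Definition sort_perm (g : {ffun 'I_k -> 'I_q}) : 'S_k :=
  insubd (1%g : 'S_k) [ffun l => rank g l].

Lemma sort_permE (g : {ffun 'I_k -> 'I_q}) : injective g ->
  sort_perm g =1 rank g.
Proof.
move=> /rank_inj r_inj l; rewrite /sort_perm -pvalE insubdK ?ffunE //.
by apply/injectiveP => i j; rewrite !ffunE => /r_inj.
Qed.

Lemma increasing_ltn (g : {ffun 'I_k -> 'I_q}) : increasing g ->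
  forall i j, (g i < g j)%N = (i < j)%N.
Proof.
move=> /forallP incr i j; have inc (a b : 'I_k) : (a < b)%N -> (g a < g b)%N.
  by move: (incr a) => /forallP/(_ b)/implyP.
have [/inc //|/inc|/val_inj ->] := ltngtP i j; last by rewrite ltnn.
by move=> /ltnW; rewrite leqNgt => /negbTE.
Qed.

Lemma increasing_inj (g : {ffun 'I_k -> 'I_q}) : increasing g -> injective g.
Proof.
move=> /increasing_ltn incr i j e; apply/val_inj/eqP.
by rewrite eqn_leq [X in X && _]leqNgt [X in _ && X]leqNgt -!incr e ltnn.
Qed.

(** An injective multi-index is in exactly one way an increasing one followed by a permutation of
    the places, so each increasing term is met [k!] times; the terms with a repeated index
    vanish. *)
Lemma sum_increasing (W : nmodType) (F : ('I_k -> 'I_q) -> W) :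
  (forall g (s : 'S_k), F (g \o s) = F g) ->
  (forall g i j, i != j -> g i = g j -> F g = 0) ->
  \sum_(g : {ffun 'I_k -> 'I_q}) F g
  = (\sum_(g : {ffun 'I_k -> 'I_q} | increasing g) F g) *+ k`!.
Proof.
move=> F_perm F0.
rewrite (bigID (fun g : {ffun 'I_k -> 'I_q} => injectiveb g)) /=.
rewrite [X in _ + X]big1 ?addr0 => [|g /injectivePn[i [j ij gij]]]; last first.
  exact: F0 ij gij.
pose h (p : {ffun 'I_k -> 'I_q} * 'S_k) : {ffun 'I_k -> 'I_q} :=
  [ffun l => p.1 (p.2 l)].
pose h' (g : {ffun 'I_k -> 'I_q}) :=
  ([ffun l => g ((sort_perm g)^-1%g l)] : {ffun 'I_k -> 'I_q}, sort_perm g).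
rewrite (reindex_onto h h') /=; last first.
  by move=> g _; apply/ffunP => l; rewrite !ffunE permK.
rewrite (eq_bigl (fun p : _ * 'S_k => increasing p.1 && true)) => [|[I s]].
  rewrite -(pair_big (@increasing k q) xpredT (fun I s => F (h (I, s)))) /=.
  rewrite -sumrMnl; apply: eq_bigr => I _.
  rewrite (eq_bigr (fun=> F I)) => [|s _]; last first.
    by rewrite -[RHS](F_perm I s); congr F; apply/funext => l; rewrite ffunE.
  by rewrite sumr_const -/'S_k card_Sn.
rewrite andbT /=; apply/andP/idP => [[/injectiveP]|incr].
  set g := h (I, s) => g_inj /eqP[IE _].
  apply/forallP => i; apply/forallP => j; apply/implyP => ij.
  have gE l : I l = g ((sort_perm g)^-1%g l) by rewrite -{1}IE ffunE.
  rewrite !gE ltnNge; apply/negP => /(@leq_rank g).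
  by rewrite -!(sort_permE g_inj) !permKV leqNgt ij.
have hI : injective (h (I, s)).
  by move=> i j; rewrite !ffunE => /(increasing_inj incr) /perm_inj.
split; first exact/injectiveP.
have sE : sort_perm (h (I, s)) = s.
  apply/permP => l; rewrite sort_permE //; apply/val_inj => /=.
  rewrite -sum1_card (eq_bigl (fun l' => s l' < s l)%N) => [|l']; last first.
    by rewrite inE /= !ffunE increasing_ltn.
  rewrite (reindex_perm s^-1%g) (eq_bigl (fun a : 'I_k => a < s l)%N) => [|a].
    by rewrite (big_ord_narrow (ltnW (ltn_ord (s l)))) sum1_card card_ord.
  by rewrite /= permKV.
rewrite /h' sE; apply/eqP; congr pair.
by apply/ffunP => l; rewrite !ffunE permKV.
Qed.

End IncreasingSums.

(** * Contractions *)

Section Contractions.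
Context {R : realType} {V : vectType R}.

Definition cobasis n (b : n.-tuple V) (i : 'I_n) : dual V :=
  linfun (coord b i : V -> R^o).

Lemma cobasisE n (b : n.-tuple V) i v : cobasis b i v = coord b i v.
Proof. by rewrite lfunE. Qed.

Lemma basis_sum n (b : n.-tuple V) v : basis_of {: V} b ->
  v = \sum_i coord b i v *: tnth b i.
Proof.
move=> bB; rewrite [LHS](coord_basis bB (memvf v)).
by apply: eq_bigr => i _; rewrite (tnth_nth 0).
Qed.

Lemma cobasis_sum n (b : n.-tuple V) (xi : dual V) : basis_of {: V} b ->
  xi = \sum_i (xi (tnth b i) : R) *: cobasis b i.
Proof.
move=> bB; apply/lfunP => v; rewrite sum_lfunE {1}(basis_sum v bB) linear_sum.
apply: eq_bigr => i _; rewrite linearZ scale_lfunE cobasisE.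
exact: mulrC.
Qed.

Lemma multilin_basis k n (f : ('I_k -> V) -> R) (b : n.-tuple V) v :
  basis_of {: V} b -> multilinear f ->
  f v = \sum_(g : {ffun 'I_k -> 'I_n})
          (\prod_j coord b (g j) (v j)) * f (fun j => tnth b (g j)).
Proof.
move=> bB fL; rewrite -(multilin_expand (fun j a => coord b a (v j)) _ fL).
by congr f; apply/funext => j; exact: basis_sum.
Qed.

Lemma multilin_cobasis k n (P : ('I_k -> dual V) -> R) (b : n.-tuple V) xi :
  basis_of {: V} b -> multilinear P ->
  P xi = \sum_(g : {ffun 'I_k -> 'I_n})
          (\prod_j (xi j (tnth b (g j)) : R)) * P (fun j => cobasis b (g j)).
Proof.
move=> bB PL; rewrite -(multilin_expand (fun j a => xi j (tnth b a) : R) _ PL).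
by congr P; apply/funext => j; exact: cobasis_sum.
Qed.

(** Expanding [alpha] in [b'] on the left and [P] in the dual basis of [b] on the right gives the
    same coefficients, the coordinates in [b'] of the vectors of [b]. *)
Lemma contract_change k n n' (b : n.-tuple V) (b' : n'.-tuple V)
    (alpha : ('I_k -> V) -> R) (P : ('I_k -> dual V) -> R) :
  basis_of {: V} b -> basis_of {: V} b' ->
  multilinear alpha -> multilinear P ->
  \sum_(g : {ffun 'I_k -> 'I_n})
     alpha (fun l => tnth b (g l)) * P (fun l => cobasis b (g l))
  = \sum_(g : {ffun 'I_k -> 'I_n'})
     alpha (fun l => tnth b' (g l)) * P (fun l => cobasis b' (g l)).
Proof.
move=> bB b'B aL PL.
under eq_bigr => g _ do rewrite (multilin_basis _ b'B aL) mulr_suml.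
rewrite exchange_big /=; apply: eq_bigr => g' _.
rewrite (multilin_cobasis _ bB PL) mulr_sumr; apply: eq_bigr => g _.
rewrite mulrAC mulrC; congr (_ * (_ * _)).
by apply: eq_bigr => j _; rewrite cobasisE.
Qed.

(** This is what allows a contraction to be computed in a smooth frame instead of [vbasis]. *)
Lemma contract_full k n (b : n.-tuple V)
    (alpha : ('I_k -> V) -> R) (P : ('I_k -> dual V) -> R) :
  basis_of {: V} b -> alternating alpha -> alternating P ->
  contract alpha P *+ k`! = \sum_(g : {ffun 'I_k -> 'I_n})
     alpha (fun l => tnth b (g l)) * P (fun l => cobasis b (g l)).
Proof.
move=> bB aA PA; have [[aL a0] [PL P0]] := (aA, PA).
rewrite -(contract_change (vbasisP fullv) bB) //.
rewrite (sum_increasing (F := fun g : 'I_k -> 'I_(\dim {: V}) =>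
  alpha (fun l => base (g l)) * P (fun l => cobase (g l)))) //.
- move=> g s; rewrite (alt_perm aA (fun l => base (g l)) s).
  rewrite (alt_perm PA (fun l => cobase (g l)) s) mulrACA -signr_addb addbb.
  by rewrite mul1r.
- by move=> g i j ij gij; rewrite (a0 _ i j) ?mul0r ?gij.
Qed.

Lemma alternating_vrcons k (P : ('I_k.+1 -> dual V) -> R) xi :
  alternating P -> alternating (fun eta => P (vrcons eta xi)).
Proof.
move=> [PL P0]; split.
  exact: (multilin_insert ord_max xi PL).
move=> eta i j ij e; apply: (P0 _ (lift ord_max i) (lift ord_max j)).
  by rewrite (inj_eq (@lift_inj _ _)).
by rewrite /vrcons !liftK.
Qed.

Lemma contract_sharp k (alpha : ('I_k -> V) -> R) (P : ('I_k.+1 -> dual V) -> R)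
    (xi : dual V) : multilinear P ->
  xi (sharp alpha P) = contract alpha (fun eta => P (vrcons eta xi)).
Proof.
move=> PL; rewrite /sharp linear_sum; apply: eq_bigr => I _.
rewrite linear_sum {2}(cobasis_sum xi (vbasisP fullv)).
have E u : vrcons (fun l => cobase (I l)) u
    = upd (insert ord_max 0 (fun l => cobase (I l))) ord_max u.
  by rewrite upd_insert.
rewrite E (multilin_sum PL) mulr_sumr; apply: eq_bigr => j _.
by rewrite linearZ (multilinZ PL) -E mulrA [RHS]mulrAC.
Qed.

Lemma contract_linear k a (alpha beta : ('I_k -> V) -> R) P :
  contract (fun v => a * alpha v + beta v) P
  = a * contract alpha P + contract beta P.
Proof.
rewrite /contract mulr_sumr -big_split; apply: eq_bigr => I _ /=.
by rewrite mulrDl mulrA.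
Qed.

Lemma sharp_linear k a (alpha beta : ('I_k -> V) -> R) P :
  sharp (fun v => a * alpha v + beta v) P
  = a *: sharp alpha P + sharp beta P.
Proof.
rewrite /sharp scaler_sumr -big_split; apply: eq_bigr => I _ /=.
rewrite scaler_sumr -big_split; apply: eq_bigr => j _ /=.
by rewrite scalerA -scalerDl mulrDl !mulrA.
Qed.

Lemma mulrn_fact_inj k : injective (fun x : R => x *+ k`!).
Proof.
move=> x y /eqP; rewrite -subr_eq0 -mulrnBl mulrn_eq0 subr_eq0.
by rewrite -leqn0 leqNgt fact_gt0 => /eqP.
Qed.

(** The covector comes first in the product but fills the last slot of [P] in [sharp]. Its [i]-th
    position in the product has sign [(-1)^i], and moving it to the last slot costs [(-1)^(i+k)]:
    each of the [k.+1] positions contributes the same amount, which accounts for the quotient of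
    [k.+1]! by [k]!. *)
Lemma contract_wedge k (alpha : ('I_k -> V) -> R) (P : ('I_k.+1 -> dual V) -> R)
    (xi : dual V) : alternating alpha -> alternating P ->
  contract (wedge_covector (fun v => xi v : R) alpha) P
  = (-1) ^+ k * (xi (sharp alpha P) : R).
Proof.
move=> aA PA; have PL := alternating_multilin PA.
have xiL a u w : (xi (a *: u + w) : R) = a * (xi u : R) + xi w by rewrite linearP.
have xB := vbasisP {: V}.
apply: (@mulrn_fact_inj k.+1) => /=.
rewrite (contract_full xB (wedge_covector_alt xiL aA) PA).
rewrite contract_sharp // factS mulnC mulrnA -mulrnAr.
rewrite (contract_full xB aA (alternating_vrcons xi PA)).
under eq_bigr => g _ do rewrite mulr_suml.
rewrite exchange_big /= -[X in _ *+ X](card_ord k.+1) -sumr_const.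
apply: eq_bigr => i _.
rewrite (sum_insert i (fun g : 'I_k.+1 -> 'I_(\dim {: V}) =>
  (-1) ^+ i * ((xi (tnth (vbasis {: V}) (g i)) : R) *
    alpha (fun l => tnth (vbasis {: V}) (g (lift i l))))
  * P (fun l => cobasis (vbasis {: V}) (g l)))).
rewrite exchange_big mulr_sumr /=; apply: eq_bigr => h _.
have E (u : dual V) (v : 'I_k -> dual V) :
    P (insert i u v) = (-1) ^+ (i + k) * P (vrcons v u).
  have := alt_insert (insert i u v) i ord_max PA.
  rewrite insert_at.
  rewrite (_ : (fun l => insert i u v (lift i l)) = v); last first.
    by apply/funext => l; rewrite insert_lift.
  rewrite -/(vrcons v u) => ->; rewrite mulrA -exprD addnn -mul2n exprM.
  by rewrite sqrrN expr1n expr1n mul1r.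
rewrite {2}(cobasis_sum xi xB).
have F (u : dual V) v : vrcons v u = upd (insert ord_max 0 v) ord_max u.
  by rewrite upd_insert.
rewrite F (multilin_sum PL) !mulr_sumr; apply: eq_bigr => a _.
rewrite (multilinZ PL) -F (map_insert (cobasis _)) E insert_at.
rewrite (_ : (fun l => _ (insert i a h (lift i l)))
  = (fun l => tnth (vbasis {: V}) (h l))); last first.
  by apply/funext => l; rewrite insert_lift.
have e : (-1) ^+ i * (-1) ^+ i = 1 :> R.
  by rewrite -exprD addnn -mul2n exprM sqrrN !expr1n.
rewrite exprD; set x := (xi _ : R); set y := alpha _; set z := P _.
transitivity (((-1) ^+ i * (-1) ^+ i) * ((-1) ^+ k * (y * (x * z)))); first by ring.
by rewrite e mul1r.
Qed.

Lemma top_form_det n (b : n.-tuple V) (f : ('I_n -> V) -> R) v :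
  basis_of {: V} b -> alternating f ->
  f v = \det (\matrix_(i, j) coord b i (v j)) * f (tnth b).
Proof.
move=> bB fA; have [fL f0] := fA.
rewrite (multilin_basis v bB fL).
rewrite (bigID (fun g : {ffun 'I_n -> 'I_n} => injectiveb g)) /=.
rewrite [X in _ + X]big1 ?addr0 => [|g /injectivePn[i [j ij gij]]]; last first.
  by rewrite (f0 _ i j) ?mulr0 ?gij.
rewrite (reindex (@pval _)) /=; last first.
  pose in_Sn := insubd (1%g : 'S_n).
  by exists in_Sn => /= g Ug; first apply: val_inj; apply: insubdK.
rewrite -det_tr mulr_suml; apply: eq_big => [s|s _]; first exact: (valP s).
rewrite !pvalE (alt_perm fA (tnth b) s) mulrA [X in X * _]mulrC; congr (_ * _ * _).
by apply: eq_bigr => j _; rewrite !mxE.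
Qed.

(* [xi ^ f] vanishes in degree above the top one: Cramer's rule in a basis. *)
Lemma top_form_wedge n (b : n.-tuple V) (f : ('I_n -> V) -> R) (xi : V -> R) u v :
  basis_of {: V} b -> alternating f ->
  (forall a u w, xi (a *: u + w) = a * xi u + xi w) ->
  \sum_j xi (v j) * f (upd v j u) = xi u * f v.
Proof.
move=> bB fA xiL; pose C := \matrix_(i, j) coord b i (v j).
have xi_sum w : xi w = \sum_a coord b a w * xi (tnth b a).
  have xi0 : xi 0 = 0.
    have := xiL 1 0 0; rewrite scale1r addr0 mul1r => /eqP.
    by rewrite -subr_eq subrr eq_sym => /eqP.
  rewrite {1}(basis_sum w bB); apply: (big_rec2 (fun y z => xi y = z)) => //.
  by move=> a y z _ <-; rewrite xiL.
have fE j : f (upd v j u) = (\sum_i coord b i u * cofactor C i j) * f (tnth b).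
  rewrite (top_form_det _ bB fA); congr (_ * _).
  rewrite (expand_det_col _ j); apply: eq_bigr => i _.
  rewrite mxE upd_at; congr (_ * (_ * \det _)).
  by apply/matrixP => k l; rewrite !mxE upd_off // eq_sym neq_lift.
under eq_bigr => j _ do rewrite fE xi_sum mulrA mulr_suml.
rewrite -mulr_suml (top_form_det v bB fA) mulrA -/C; congr (_ * _).
rewrite exchange_big /= xi_sum mulr_suml; apply: eq_bigr => a _.
transitivity (\sum_j \sum_i C a j * \adj C j i * (coord b i u * xi (tnth b a))).
  apply: eq_bigr => j _; rewrite mulr_sumr; apply: eq_bigr => i _.
  by rewrite !mxE; ring.
rewrite exchange_big /=.
have CE i : \sum_j C a j * \adj C j i = (\det C)%:M a i.
  by rewrite -mul_mx_adj mxE.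
under eq_bigr => i _ do rewrite -mulr_suml CE !mxE.
rewrite (bigD1 a) //= big1 => [|i ia]; last by rewrite eq_sym (negPf ia) mul0r.
by rewrite eqxx mulr1n addr0; ring.
Qed.

End Contractions.

(** * Smooth functions *)

Section DirectionalDerivative.
Context {R : realType} {d : nat}.
Implicit Types (f g : 'rV[R]_d -> R) (x v : 'rV[R]_d).

Lemma derive_line f x v :
  'D_v f x = 'D_1 (fun t : R => f (t *: v + x)) 0.
Proof.
set g := fun t : R => f (t *: v + x).
suff E : (fun t : R => t^-1 *: ((f \o shift x) (t *: v) - f x))
    = (fun t : R => t^-1 *: ((g \o shift 0) (t *: 1) - g 0)) by rewrite /derive E.
apply/funext => t /=.
by rewrite /g addr0 scale0r add0r /GRing.scale /= mulr1.
Qed.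

(** Only the derivative of [f] along [v] is available, so the one-variable chain rule is applied on
    the line through [x] in the direction [v]. *)
Lemma is_derive_comp f (h : R -> R) x v (l : R) :
  derivable f x v -> is_derive (f x) 1 h l ->
  is_derive x v (fun y => h (f y)) (l * 'D_v f x).
Proof.
move=> fx [hx <-]; set p := fun t : R => f (t *: v + x).
have p0 : p 0 = f x by rewrite /p scale0r add0r.
have px : derivable p 0 1 := (derivable1P f x v).1 fx.
have hp : derivable h (p 0) 1 by rewrite p0.
have hpx : is_derive (0 : R) (1 : R) (h \o p : R -> R) ('D_1 h (f x) * 'D_1 p 0).
  by rewrite -p0; apply: is_derive1_comp; split.
case: hpx => hpx hpE; split; first exact: (derivable1P (h \o f) x v).2.
by rewrite !derive_line.
Qed.

End DirectionalDerivative.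

Section ContinuouslyDifferentiable.
Context {R : realType} {d : nat}.
Implicit Types (U W : set 'rV[R]_d) (f g : 'rV[R]_d -> R).

Lemma CkW k U f : Ck k.+1 U f -> Ck k U f.
Proof.
elim: k f => [|k IHk] f [fc fD]; first by split.
by split => // i; have [fi /IHk] := fD i.
Qed.

(** Every clause of [Ck] is a condition at one point of the set on the function in the ambient
    space, so membership in [W] is enough to transfer it. *)
Lemma Ck_local k U f :
  (forall x, U x -> exists2 W, W x & Ck k W f) -> Ck k U f.
Proof.
elim: k f => [|k IHk] f fU; split => //.
- by move=> x /fU[W Wx [fc _]]; exact: fc.
- by move=> x /fU[W Wx [fc _]]; exact: fc.
move=> i; split => [x /fU[W Wx [_ /(_ i)[fi _]]]|]; first exact: fi.
by apply: IHk => x /fU[W Wx [_ /(_ i)[_ fi]]]; exists W.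
Qed.

Lemma open_near_eq U f g x : open U -> {in U, f =1 g} -> U x ->
  \forall y \near x, f y = g y.
Proof.
move=> Uo fg Ux; apply: filterS (open_nbhs_nbhs (conj Uo Ux)) => y Uy.
by apply: fg; rewrite inE.
Qed.

Lemma Ck_congr k U f g : open U -> {in U, f =1 g} -> Ck k U f -> Ck k U g.
Proof.
move=> Uo; elim: k f g => [|k IHk] f g fg [fc fD].
  split => // x Ux; have nfg := open_near_eq Uo fg Ux.
  rewrite /prop_for /continuous_at -(nbhs_singleton nfg).
  by exact: cvg_trans (near_eq_cvg nfg) (fc x Ux).
have nfg x Ux := @open_near_eq U f g x Uo fg Ux.
have [gc _] : Ck 0 U g.
  split => // x Ux; rewrite /prop_for /continuous_at -(nbhs_singleton (nfg x Ux)).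
  by exact: cvg_trans (near_eq_cvg (nfg x Ux)) (fc x Ux).
split => // i; have [fi fDi] := fD i; split => [x Ux|].
  exact: near_eq_derivable (nfg x Ux) (fi x Ux).
apply: IHk fDi => x; rewrite inE => Ux.
exact: near_eq_derive (nfg x Ux).
Qed.

Lemma Ck_cst k U (a : R) : open U -> Ck k U (fun=> a).
Proof.
move=> Uo; elim: k a => [|k IHk] a; split => //.
- by move=> x _; exact: cst_continuous.
- by move=> x _; exact: cst_continuous.
move=> i; split => [x _|]; first exact: derivable_cst.
by apply: Ck_congr (IHk 0) => // x _; rewrite derive_cst.
Qed.

Lemma CkD k U f g : open U -> Ck k U f -> Ck k U g ->
  Ck k U (fun x => f x + g x).
Proof.
move=> Uo; elim: k f g => [|k IHk] f g [fc fD] [gc gD]; split => //.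
- by move=> x Ux; exact: cvgD (fc x Ux) (gc x Ux).
- by move=> x Ux; exact: cvgD (fc x Ux) (gc x Ux).
move=> i; have [[fi fDi] [gi gDi]] := (fD i, gD i); split => [x Ux|].
  by apply: derivableD; [exact: fi|exact: gi].
apply: Ck_congr (IHk _ _ fDi gDi) => // x; rewrite inE => Ux.
by rewrite (deriveD (fi x Ux) (gi x Ux)).
Qed.

Lemma CkM k U f g : open U -> Ck k U f -> Ck k U g ->
  Ck k U (fun x => f x * g x).
Proof.
move=> Uo; elim: k f g => [|k IHk] f g fU gU.
  by split => // x Ux; exact: cvgM (fU.1 x Ux) (gU.1 x Ux).
have [[fc fD] [gc gD]] := (fU, gU).
split => [x Ux|i]; first by exact: cvgM (fc x Ux) (gc x Ux).
have [[fi fDi] [gi gDi]] := (fD i, gD i); split => [x Ux|].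
  by apply: derivableM; [exact: fi|exact: gi].
apply: Ck_congr (CkD Uo (IHk _ _ (CkW fU) gDi) (IHk _ _ (CkW gU) fDi)) => // x.
by rewrite inE => Ux; rewrite (deriveM (fi x Ux) (gi x Ux)).
Qed.

(** The family [H] is closed under differentiation: the derivatives of [H n \o f] involve only
    [H n.+1 \o f], [H n.+2 \o f] and a derivative of [f]. The induction on [k] therefore runs for
    all [n] at once. *)
Lemma Ck_comp (H : nat -> R -> R) (a c : nat -> R) (D : set R) k n U f :
  (forall n t, D t ->
     is_derive t 1 (H n) (a n * H n.+1 t + c n * H n.+2 t)) ->
  open U -> U `<=` f @^-1` D -> Ck k U f -> Ck k U (fun x => H n (f x)).
Proof.
move=> HD Uo UD fU.
have Hc x m : U x -> {for x, continuous (fun y => H m (f y))}.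
  move=> Ux; apply: (@continuous_comp _ _ _ f (H m)).
    by case: k fU => [|k] [fc _]; exact: fc.
  apply/differentiable_continuous/derivable1_diffP.
  by have [] := HD m _ (UD x Ux).
elim: k n fU => [|k IHk] n fU; split => //; try by move=> x; exact: Hc.
move=> i; have [fc /(_ i)[fi fDi]] := fU.
have D' x (Ux : U x) := is_derive_comp (fi x Ux) (HD n _ (UD x Ux)).
split => [x Ux|]; first by have [] := D' x Ux.
have Hk m : Ck k U (fun x => H m (f x)) by apply: IHk; exact: CkW.
apply: Ck_congr (CkM Uo (CkD Uo (CkM Uo (Ck_cst k (a n) Uo) (Hk n.+1))
  (CkM Uo (Ck_cst k (c n) Uo) (Hk n.+2))) fDi) => // x.
by rewrite inE => Ux; have [_ ->] := D' x Ux.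
Qed.

End ContinuouslyDifferentiable.

(** * Logarithms, negative powers and the flat function *)

Section ScalarFunctions.
Context {R : realType}.

(* [log_family] and [flat] satisfy the hypothesis of [Ck_comp], which thereby
   covers logarithms, inverses and bump functions at once. *)
Definition log_family (n : nat) (t : R) : R :=
  if n is n'.+1 then t ^- n else ln `|t|.

Lemma log_family_derive n (t : R) : t != 0 ->
  is_derive t 1 (log_family n)
    ((if n is n'.+1 then - n%:R else 1) * log_family n.+1 t
     + 0 * log_family n.+2 t).
Proof.
move=> t0; rewrite mul0r addr0; case: n => [|n] /=.
  rewrite mul1r expr1; case/lt_total/orP: (t0) => [t_lt0|t_gt0].
    have mt0 : 0 < - t by rewrite oppr_gt0.
    have D := is_derive1_comp (f := @ln R) (g := -%R) (x := t) (is_derive1_ln mt0)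
      (is_deriveNid t 1).
    rewrite invrN mulrN1 opprK in D.
    apply: near_eq_is_derive D; apply: filterS (lt_nbhsl t_lt0) => s /= s_lt0.
    by rewrite ltr0_norm.
  apply: near_eq_is_derive (is_derive1_ln t_gt0).
  by apply: filterS (lt_nbhsr t_gt0) => s /= s_gt0; rewrite gtr0_norm.
have tn0 : t ^+ n.+1 != 0 by rewrite expf_neq0.
have D0 : is_derive t 1 (fun s : R => s ^+ n.+1) (n.+1%:R * t ^+ n).
  by split; [exact: exprn_derivable|rewrite exp_derive /GRing.scale /= mulr1].
have := is_deriveV (f := fun s : R => s ^+ n.+1) tn0 D0.
move=> D; apply: (is_derive_eq D); rewrite /GRing.scale /=.
rewrite !exprS; field.
by rewrite t0 expf_neq0.
Qed.

Definition flat (n : nat) (t : R) : R :=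
  if 0 < t then t ^- n * expR (- t^-1) else 0.

Lemma flat_pos n t : 0 < t -> 0 < flat n t.
Proof. by move=> t0; rewrite /flat t0 mulr_gt0 ?expR_gt0 // invr_gt0 exprn_gt0. Qed.

(** From [exp(s) >= s^(n+1) / (n+1)!] at [s = 1/t]. The linear bound controls the difference
    quotients at 0. *)
Lemma flat_le n t : `|flat n t| <= n.+1`!%:R * `|t|.
Proof.
rewrite /flat; case: ifPn => [t0|_]; last by rewrite normr0 mulr_ge0.
rewrite ger0_norm ?mulr_ge0 ?expR_ge0 ?invr_ge0 ?exprn_ge0 ?(ltW t0) //.
rewrite gtr0_norm // expRN ler_pdivrMr ?expR_gt0 //.
have tV0 : 0 <= t^-1 by rewrite invr_ge0 ltW.
have := expR_ge1Dxn n tV0; set e := expR _ => le_e.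
have {le_e} : t^-1 ^+ n.+1 <= n.+1`!%:R * e.
  rewrite mulrC -ler_pdivrMr ?ltr0n ?fact_gt0 //.
  by apply: le_trans le_e; rewrite lerDr.
rewrite -(ler_pM2l t0) exprS mulrA divff ?mul1r ?gt_eqF // exprVn.
by rewrite mulrA [t * _]mulrC.
Qed.

Lemma flat_derive n (t : R) : is_derive t 1 (flat n)
  (- n%:R * flat n.+1 t + 1 * flat n.+2 t).
Proof.
have [t0|t0|->] := ltgtP t 0.
- have -> : - n%:R * flat n.+1 t + 1 * flat n.+2 t = 0.
    by rewrite /flat ltNge (ltW t0) /= !mulr0 addr0.
  apply: near_eq_is_derive (is_derive_cst (0 : R) t 1).
  by apply: filterS (lt_nbhsl t0) => s /= s0; rewrite /flat ltNge ltW.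
- have tN0 : t != 0 by rewrite gt_eqF.
  have Dinv : is_derive t 1 (fun s : R => - s^-1) (t ^- 2).
    have D := is_deriveN (log_family_derive 1%N tN0).
    by apply: (is_derive_eq D) => /=; rewrite mul0r addr0 mulN1r opprK.
  have Dexp := is_derive1_comp (g := fun s : R => - s^-1)
    (is_derive_expR (- t^-1)) Dinv.
  have Dpow : is_derive t 1 (fun s : R => s ^- n) (- n%:R * t ^- n.+1).
    case: n => [|n].
      rewrite (_ : (fun s : R => s ^- 0) = cst 1); last first.
        by apply/funext => s; rewrite expr0 invr1.
      by rewrite oppr0 mul0r; exact: is_derive_cst.
    have D := log_family_derive n.+1 tN0; apply: (is_derive_eq D) => /=.
    by rewrite mul0r addr0.
  have := is_deriveM Dpow Dexp; rewrite /flat t0 => D.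
  apply: near_eq_is_derive (is_derive_eq D _).
    by apply: filterS (lt_nbhsr t0) => s /= ->.
  rewrite /GRing.scale /= !exprS; field.
  by rewrite tN0 expf_neq0.
have flat0 m : flat m 0 = 0 by rewrite /flat ltxx.
rewrite !flat0 !mulr0 addr0.
(* At 0 the difference quotient of [flat n] is exactly [flat n.+1], which tends to 0 by
   [flat_le]. *)
have growth : (fun h : R => h^-1 *: ((flat n \o shift 0) (h *: 1) - flat n 0))
    = flat n.+1.
  apply/funext => h /=; rewrite flat0 subr0 addr0 /GRing.scale /= mulr1 /flat.
  case: ifPn => _; last by rewrite mulr0.
  by rewrite mulrA exprS invfM.
have lim0 : flat n.+1 h @[h --> 0^'] --> 0.
  apply/cvgr0Pnorm_le => e e0; near=> h.
  apply: le_trans (flat_le _ _) _.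
  rewrite mulrC -ler_pdivlMr ?ltr0n ?fact_gt0 //; near: h.
  by apply: dnbhs0_le; rewrite divr_gt0 ?ltr0n ?fact_gt0.
split; first by rewrite /derivable growth; apply/cvg_ex; exists 0.
by rewrite /derive growth; exact: cvg_lim.
Unshelve. all: by end_near.
Qed.

End ScalarFunctions.

(** * Smooth functions on the manifold and bump functions *)

Section SmoothFunctionsTheory.
Context {R : realType} {d : nat} {M : manifold R d}.
Implicit Types (U V W : set M) (f g : M -> R) (x : M).

Lemma chart_preimage_open U (c : chart R d M) :
  open U -> open (cimg c `&` cinv c @^-1` U).
Proof.
rewrite !openE => Uo y [cy Uy]; apply: filterI.
  exact: (open_nbhs_nbhs (conj (@cimg_open _ _ _ c) cy)).
exact: (@cinv_continuous _ _ _ c y cy) (Uo _ Uy).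
Qed.

Lemma smooth_on_local U f :
  (forall x, U x -> exists2 V, V x & smooth_on V f) -> smooth_on U f.
Proof.
move=> fU c ac k; apply: Ck_local => y [cy Uy].
by have [V Vx fV] := fU _ Uy; exists (cimg c `&` cinv c @^-1` V); last exact: fV.
Qed.

Lemma smooth_on_sub U V f : V `<=` U -> smooth_on U f -> smooth_on V f.
Proof. by move=> VU fU; apply: smooth_on_local => x /VU; exists U. Qed.

Lemma smooth_smooth_on U f : smooth f -> smooth_on U f.
Proof. exact: smooth_on_sub. Qed.

Lemma smooth_on_congr U f g :
  open U -> (forall x, U x -> f x = g x) -> smooth_on U f -> smooth_on U g.
Proof.
move=> Uo fg fU c ac k; apply: Ck_congr (fU c ac k).
  exact: chart_preimage_open.
by move=> y; rewrite inE => -[_ Uy]; exact: fg.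
Qed.

Lemma smooth_on_cst U (a : R) : open U -> smooth_on U (fun=> a).
Proof. by move=> Uo c ac k; apply: Ck_cst; exact: chart_preimage_open. Qed.

Lemma smooth_onD U f g : open U -> smooth_on U f -> smooth_on U g ->
  smooth_on U (fun x => f x + g x).
Proof.
move=> Uo fU gU c ac k; apply: (CkD _ (fU c ac k) (gU c ac k)).
exact: chart_preimage_open.
Qed.

Lemma smooth_onM U f g : open U -> smooth_on U f -> smooth_on U g ->
  smooth_on U (fun x => f x * g x).
Proof.
move=> Uo fU gU c ac k; apply: (CkM _ (fU c ac k) (gU c ac k)).
exact: chart_preimage_open.
Qed.

Lemma smooth_on_sum U (I : Type) (s : seq I) (P : pred I) (F : I -> M -> R) :
  open U -> (forall i, P i -> smooth_on U (F i)) ->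
  smooth_on U (fun x => \sum_(i <- s | P i) F i x).
Proof.
move=> Uo FU; rewrite (_ : (fun x => _) = \sum_(i <- s | P i) F i); last first.
  by apply/funext => x; rewrite fct_sumE.
elim/big_ind: _ => //; first exact: smooth_on_cst.
by move=> f g fU gU; exact: smooth_onD fU gU.
Qed.

Lemma smooth_on_prod U (I : Type) (s : seq I) (P : pred I) (F : I -> M -> R) :
  open U -> (forall i, P i -> smooth_on U (F i)) ->
  smooth_on U (fun x => \prod_(i <- s | P i) F i x).
Proof.
move=> Uo FU; elim: s => [|i s IHs].
  by under eq_fun do rewrite big_nil; exact: smooth_on_cst.
under eq_fun do rewrite big_cons.
by case: (boolP (P i)) => // Pi; apply: smooth_onM => //; exact: FU.
Qed.

Lemma smooth_on_comp (H : nat -> R -> R) (a c : nat -> R) (D : set R) n U f :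
  (forall n t, D t ->
     is_derive t 1 (H n) (a n * H n.+1 t + c n * H n.+2 t)) ->
  open U -> (forall x, U x -> D (f x)) -> smooth_on U f ->
  smooth_on U (fun x => H n (f x)).
Proof.
move=> HD Uo UD fU e ae k; apply: (Ck_comp (f := f \o cinv e) n HD _ _ (fU e ae k)).
  exact: chart_preimage_open.
by move=> y [_ /UD].
Qed.

Lemma smooth_on_log U f n : open U -> (forall x, U x -> f x != 0) ->
  smooth_on U f -> smooth_on U (fun x => log_family n (f x)).
Proof.
move=> Uo f0; pose a n := (if n is n'.+1 then - n%:R else 1) : R.
exact: (@smooth_on_comp _ a (fun=> 0) (fun t => t != 0) n _ _
  (@log_family_derive R)).
Qed.

Lemma smooth_onV U f : open U -> (forall x, U x -> f x != 0) ->
  smooth_on U f -> smooth_on U (fun x => (f x)^-1).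
Proof. exact: (@smooth_on_log _ _ 1). Qed.

Lemma smooth_on_exp U f : open U -> smooth_on U f ->
  smooth_on U (fun x => expR (f x)).
Proof.
move=> Uo; apply: (@smooth_on_comp (fun=> expR) (fun=> 1) (fun=> 0) setT 0%N) => //.
move=> _ t _; rewrite mul1r mul0r addr0; exact: is_derive_expR.
Qed.

(** Since [K] is closed, its complement and [U] form an open cover, and a product with a function
    smooth only on [U] is smooth across the boundary of [U]. *)
Definition supported_in U f :=
  exists K : set M, [/\ closed K, K `<=` U & forall y, ~ K y -> f y = 0].

Lemma smooth_on_bumpM U V b f : open U -> open V -> smooth b ->
  supported_in U b -> smooth_on (V `&` U) f -> smooth_on V (fun x => b x * f x).
Proof.
move=> Uo Vo bS [K [Kc KU b0]] fS; apply: smooth_on_local => x Vx.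
have [Kx|nKx] := pselect (K x).
  exists (V `&` U); first by split => //; exact: KU.
  apply: smooth_onM => //; first exact: openI.
  exact: smooth_smooth_on.
exists (~` K) => //; apply: smooth_on_congr (smooth_on_cst 0 _).
- exact: closed_openC.
- by move=> y nKy; rewrite b0 // mul0r.
- exact: closed_openC.
Qed.

Lemma bump_exists U x : open U -> U x ->
  exists b : M -> R, [/\ smooth b, b x = 1 & supported_in U b].
Proof.
move=> Uo Ux; have [c ac cx] := atlas_cover x; set y0 := cmap c x.
have Wo := chart_preimage_open (c := c) Uo.
have Wy0 : (cimg c `&` cinv c @^-1` U) y0.
  by split; [exact: cmap_img|rewrite /= cmapK].
have [e /= e0 eW] : exists2 e : R, 0 < e & forall y : 'rV[R]_d,
    (forall i, `|y 0 i - y0 0 i| <= e) -> (cimg c `&` cinv c @^-1` U) y.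
  move: Wo; rewrite openE => /(_ _ Wy0) /nbhs_ballP[e /= e0 eW].
  (* Halving the radius puts a closed cube inside the open ball. *)
  exists (e / 2); first by rewrite divr_gt0.
  move=> y ye; apply: eW; split => // i j; rewrite ord1 /ball /= distrC.
  by apply: le_lt_trans (ye j) _; rewrite ltr_pdivrMr // ltr_pMr // ltr1n.
pose cube : set 'rV[R]_d :=
  [set y | forall i, `[y0 0 i - e, y0 0 i + e]%classic (y 0 i)].
have cubeP (y : 'rV[R]_d) : cube y <-> forall i, `|y 0 i - y0 0 i| <= e.
  by split=> h i; have := h i; rewrite /= in_itv /= -ler_distl.
(* The image of a compact cube, closed because the manifold is Hausdorff. *)
pose K := cinv c @` cube.
have Kclosed : closed K.
  apply: compact_closed; first exact: mspace_hausdorff.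
  apply: continuous_compact; last first.
    exact: (@rV_compact R d (fun i => `[y0 0 i - e, y0 0 i + e]%classic)
      (fun i => @segment_compact _ _ _)).
  apply: continuous_in_subspaceT => y; rewrite inE => /cubeP /eW[cy _].
  exact: cinv_continuous.
(* The Euclidean distance is used for its smooth square; [phi] is positive only inside the cube and
   equals [e ^+ 2] at [x], whence the normalizing factor in [b]. The value 0 off [cdom c] replaces
   the meaningless values of [cmap] there. *)
pose phi p := e ^+ 2 + - 1 *
  \sum_(i < d) (cmap c p 0 i - y0 0 i) * (cmap c p 0 i - y0 0 i).
pose b p := if pselect (cdom c p) then flat 0 (phi p) * (flat 0 (e ^+ 2))^-1 else 0.
have bK p : ~ K p -> b p = 0.
  rewrite /b; case: pselect => // cp nK.
  rewrite [flat 0 (phi p)]/flat ifF ?mul0r //; apply/negP => phi0; apply: nK.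
  exists (cmap c p); last exact: cmapK.
  apply/cubeP => i; rewrite -ler_sqr ?nnegrE ?(ltW e0) // real_normK ?num_real //.
  rewrite ltW //; move: phi0; rewrite /phi mulN1r subr_gt0; apply: le_lt_trans.
  rewrite (bigD1 i) //= -expr2 lerDl sumr_ge0 // => j _.
  by rewrite -expr2 sqr_ge0.
exists b; split; last 1 first.
- exists K; split => // p [y /cubeP /eW[_ Uy] <-]; exact: Uy.
- apply: smooth_on_local => p _; have [cp|ncp] := pselect (cdom c p); last first.
    exists (~` K).
      by move=> [y /cubeP /eW[cy _] yp]; apply: ncp; rewrite -yp; exact: cinv_dom.
    apply: smooth_on_congr (smooth_on_cst 0 _); rewrite ?openC //.
    by move=> q /bK.
  exists (cdom c) => //.
  have co := @cdom_open _ _ _ c.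
  have cmapS i : smooth_on (cdom c) (fun q => cmap c q 0 i).
    by move=> c' ac'; exact: atlas_compat.
  have phiS : smooth_on (cdom c) phi.
    apply: smooth_onD => //; first exact: smooth_on_cst.
    apply: smooth_onM => //; first exact: smooth_on_cst.
    apply: smooth_on_sum => // i _; apply: smooth_onM => //;
      by apply: smooth_onD => //; exact: smooth_on_cst.
  have : smooth_on (cdom c) (fun q => flat 0 (phi q) * (flat 0 (e ^+ 2))^-1).
    apply: smooth_onM => //; last exact: smooth_on_cst.
    exact: (@smooth_on_comp flat (fun n => - n%:R) (fun=> 1) setT 0%N _ _
      (fun n t _ => flat_derive n t)).
  by apply: smooth_on_congr => // q cq; rewrite /b; case: pselect.
rewrite /b; case: pselect => [{}cx|//]; rewrite /phi -/y0 big1 => [|i _].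
  by rewrite mulr0 addr0 divff // gt_eqF // flat_pos // exprn_gt0.
by rewrite subrr mulr0.
Qed.

End SmoothFunctionsTheory.

(** * Tangent vectors and sections *)

Section SmoothNear.
Context {R : realType} {d : nat} {M : manifold R d}.
Implicit Types (f g : M -> R) (x : M) (D : (M -> R) -> R).

Lemma smooth_near_cst x (a : R) : smooth_near x (fun=> a).
Proof. by exists setT; split => //; [exact: openT|exact/smooth_on_cst/openT]. Qed.

Lemma smooth_nearD x f g : smooth_near x f -> smooth_near x g ->
  smooth_near x (fun y => f y + g y).
Proof.
move=> [U [Uo Ux fU]] [V [Vo Vx gV]]; exists (U `&` V); split => //.
  exact: openI.
apply: smooth_onD; first exact: openI.
  by apply: smooth_on_sub fU => y [].
by apply: smooth_on_sub gV => y [].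
Qed.

Lemma smooth_nearM x f g : smooth_near x f -> smooth_near x g ->
  smooth_near x (fun y => f y * g y).
Proof.
move=> [U [Uo Ux fU]] [V [Vo Vx gV]]; exists (U `&` V); split => //.
  exact: openI.
apply: smooth_onM; first exact: openI.
  by apply: smooth_on_sub fU => y [].
by apply: smooth_on_sub gV => y [].
Qed.

Lemma smooth_near_sum x (I : Type) (s : seq I) (F : I -> M -> R) :
  (forall i, smooth_near x (F i)) ->
  smooth_near x (fun y => \sum_(i <- s) F i y).
Proof.
move=> FS; elim: s => [|i s IHs].
  by under eq_fun do rewrite big_nil; exact: smooth_near_cst.
by under eq_fun do rewrite big_cons; exact: smooth_nearD.
Qed.

Lemma smooth_near_prod x (I : Type) (s : seq I) (F : I -> M -> R) :
  (forall i, smooth_near x (F i)) ->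
  smooth_near x (fun y => \prod_(i <- s) F i y).
Proof.
move=> FS; elim: s => [|i s IHs].
  by under eq_fun do rewrite big_nil; exact: smooth_near_cst.
by under eq_fun do rewrite big_cons; exact: smooth_nearM.
Qed.

Lemma smooth_smooth_near x f : smooth f -> smooth_near x f.
Proof. by move=> fS; exists setT; split => //; exact: openT. Qed.

Lemma smooth_near_derivable (c : chart R d M) x f i :
  atlas c -> cdom c x -> smooth_near x f ->
  derivable (f \o cinv c) (cmap c x) (delta_mx 0 i).
Proof.
move=> ac cx [U [Uo Ux fU]]; have [_ /(_ i)[fi _]] := fU c ac 1%N.
by apply: fi; split; [exact: cmap_img|rewrite /= cmapK].
Qed.

Section Tangent.
Context {x : M} {D : (M -> R) -> R}.
Hypothesis DT : tangent x D.

Lemma tangent_congr (V : set M) f g : open V -> V x ->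
  (forall y, V y -> f y = g y) -> smooth_near x f -> D f = D g.
Proof.
move=> Vo Vx Vfg [U [Uo Ux fU]]; have [c [ac cx [a Da]]] := DT.
have UVo := openI Uo Vo.
rewrite !Da; [|exists (U `&` V); split => //|by exists U].
- apply: eq_bigr => i _; congr (_ * _); apply: near_eq_derive.
  have Wo := chart_preimage_open (c := c) UVo.
  apply: filterS (open_nbhs_nbhs (conj Wo _)) => [y [_ [_ /Vfg]] //|].
  by split; [exact: cmap_img|rewrite /= cmapK].
- apply: smooth_on_congr (smooth_on_sub _ fU) => // y []// _; exact: Vfg.
Qed.

Lemma tangentD f g : smooth_near x f -> smooth_near x g ->
  D (fun y => f y + g y) = D f + D g.
Proof.
move=> fS gS; have [c [ac cx [a Da]]] := DT.
rewrite !Da //; last exact: smooth_nearD.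
rewrite -big_split; apply: eq_bigr => i _ /=; rewrite -mulrDr; congr (_ * _).
by rewrite -(deriveD (smooth_near_derivable (i := i) ac cx fS)
                     (smooth_near_derivable (i := i) ac cx gS)).
Qed.

Lemma tangentM f g : smooth_near x f -> smooth_near x g ->
  D (fun y => f y * g y) = f x * D g + D f * g x.
Proof.
move=> fS gS; have [c [ac cx [a Da]]] := DT.
rewrite !Da //; last exact: smooth_nearM.
rewrite mulr_sumr mulr_suml -big_split; apply: eq_bigr => i _ /=.
have := deriveM (smooth_near_derivable (i := i) ac cx fS)
                (smooth_near_derivable (i := i) ac cx gS).
rewrite /= cmapK // /GRing.scale /= => -> ; rewrite mulrDr.
congr (_ + _); first exact: mulrCA.
by rewrite [g x * _]mulrC mulrA.
Qed.

Lemma tangent_comp (h : R -> R) (l : R) f : smooth_near x f ->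
  smooth_near x (fun y => h (f y)) -> is_derive (f x) 1 h l ->
  D (fun y => h (f y)) = l * D f.
Proof.
move=> fS hS hD; have [c [ac cx [a Da]]] := DT.
rewrite !Da // mulr_sumr; apply: eq_bigr => i _; rewrite mulrCA; congr (_ * _).
have fi := smooth_near_derivable (i := i) ac cx fS.
have := @is_derive_comp _ _ (f \o cinv c) h (cmap c x) (delta_mx 0 i) l fi.
by rewrite /= cmapK // => /(_ hD) [_].
Qed.

Lemma tangent_cst (a : R) : D (fun=> a) = 0.
Proof.
have [c [ac cx [b Db]]] := DT; rewrite Db; last exact: smooth_near_cst.
by rewrite big1 // => i _; rewrite derive_cst mulr0.
Qed.

Lemma tangentZ (a : R) f : smooth_near x f -> D (fun y => a * f y) = a * D f.
Proof.
move=> fS; rewrite (tangentM (smooth_near_cst x a) fS) tangent_cst.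
by rewrite mul0r addr0.
Qed.

Lemma tangent_sum (I : Type) (s : seq I) (F : I -> M -> R) :
  (forall i, smooth_near x (F i)) ->
  D (fun y => \sum_(i <- s) F i y) = \sum_(i <- s) D (F i).
Proof.
move=> FS; elim: s => [|i s IHs].
  by under eq_fun do rewrite big_nil; rewrite big_nil tangent_cst.
under eq_fun do rewrite big_cons.
by rewrite big_cons tangentD ?IHs //; exact: smooth_near_sum.
Qed.

Lemma tangent_prod n (F : 'I_n -> M -> R) : (forall i, smooth_near x (F i)) ->
  D (fun y => \prod_i F i y)
  = \sum_j \prod_i (if i == j then D (F i) else F i x).
Proof.
elim: n F => [|n IHn] F FS.
  by under eq_fun do rewrite big_ord0; rewrite big_ord0 tangent_cst.
under eq_fun do rewrite big_ord_recl.
rewrite tangentM ?IHn //; last exact: smooth_near_prod.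
rewrite [RHS]big_ord_recl addrC; congr (_ + _).
  by rewrite big_ord_recl eqxx.
by rewrite mulr_sumr; apply: eq_bigr => j _; rewrite big_ord_recl.
Qed.

End Tangent.
End SmoothNear.

Section SectionsTheory.
Context {R : realType} {d : nat} {M : manifold R d} {r : nat}.
Context {A : vector_bundle M r}.
Implicit Types (X Y : sect A) (e : local_frame r A).

Lemma smooth_sect_lin f X Y : smooth f -> smooth_sect X -> smooth_sect Y ->
  smooth_sect (fun x => f x *: X x + Y x).
Proof.
move=> fS XS YS e eF i; have eo := frame_open eF.
under eq_fun do rewrite linearP /=.
apply: smooth_onD => //; last exact: YS.
by apply: smooth_onM => //; [exact: smooth_smooth_on|exact: XS].
Qed.

Lemma smooth_sect0 : smooth_sect (fun x => 0 : A x).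
Proof.
move=> e eF i; under eq_fun do rewrite linear0.
exact/smooth_on_cst/(frame_open eF).
Qed.

Lemma smooth_sectZ f X : smooth f -> smooth_sect X ->
  smooth_sect (fun x => f x *: X x).
Proof.
move=> fS XS; rewrite (_ : (fun x => _) = (fun x => f x *: X x + 0)).
  exact: smooth_sect_lin smooth_sect0.
by apply/functional_extensionality_dep => x; rewrite addr0.
Qed.

Lemma smooth_sect_sum (I : Type) (s : seq I) (g : I -> M -> R)
    (X : I -> sect A) :
  (forall j, smooth (g j)) -> (forall j, smooth_sect (X j)) ->
  smooth_sect (fun x => \sum_(j <- s) g j x *: X j x).
Proof.
move=> gS XS; elim: s => [|j s IHs].
  rewrite (_ : (fun x => _) = (fun x => 0)); first exact: smooth_sect0.
  by apply/functional_extensionality_dep => x; rewrite big_nil.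
rewrite (_ : (fun x => _) = (fun x => g j x *: X j x
    + \sum_(i <- s) g i x *: X i x)); first exact: smooth_sect_lin.
by apply/functional_extensionality_dep => x; rewrite big_cons.
Qed.

(** Brackets and forms are only controlled on global sections; with [b] supported in the domain of
    [e], the frame vectors become global. *)
Definition frame_sect e (b : M -> R) (j : 'I_r) : sect A :=
  fun y => b y *: tnth (e y) j.

Lemma frame_sect_smooth e b j : frames e -> smooth b ->
  supported_in (fdom e) b -> smooth_sect (frame_sect e b j).
Proof.
move=> eF bS bs e' e'F i; under eq_fun do rewrite linearZ /=.
apply: (smooth_on_bumpM _ _ bS bs); try exact: frame_open.
exact: frame_compat.
Qed.

Lemma smooth_sect_through x (v : A x) : exists X, smooth_sect X /\ X x = v.
Proof.
have [e eF ex] := frame_cover A x.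
have [b [bS bx bs]] := bump_exists (frame_open eF) ex.
exists (fun y => \sum_j coord (e x) j v *: frame_sect e b j y); split.
  apply: (@smooth_sect_sum _ _ (fun j => fun=> coord (e x) j v)).
    by move=> j; exact/smooth_on_cst/openT.
  by move=> j; exact: frame_sect_smooth.
rewrite [RHS](basis_sum v (frame_basis eF ex)).
by apply: eq_bigr => j _; rewrite /frame_sect bx scale1r.
Qed.

(** One factor [b] makes the coordinates of [X] globally smooth, the other one the frame vectors. *)
Lemma bump_sq_expand e (b : M -> R) X y : frames e -> supported_in (fdom e) b ->
  (b y * b y) *: X y
  = \sum_j (b y * coord (e y) j (X y)) *: frame_sect e b j y.
Proof.
move=> eF [K [_ KU b0]]; have [Ky|/b0 ->] := pselect (K y); last first.
  by rewrite mul0r scale0r big1 // => j _; rewrite mul0r scale0r.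
rewrite {1}(basis_sum (X y) (frame_basis eF (KU _ Ky))) scaler_sumr.
by apply: eq_bigr => j _; rewrite /frame_sect !scalerA mulrAC.
Qed.

End SectionsTheory.

(** * The Koszul formula *)

Section Koszul.
Context {R : realType} {d : nat} {M : manifold R d} {r : nat}.
Context {A : lie_algebroid M r}.
Implicit Types (X Y Z V W : sect A) (f g : M -> R) (x : M).

Lemma bracket_linr V g Y Z x : smooth g ->
  smooth_sect V -> smooth_sect Y -> smooth_sect Z ->
  bracket V (fun y => g y *: Y y + Z y) x
  = g x *: bracket V Y x + anchor (V x) g *: Y x + bracket V Z x.
Proof.
move=> gS VS YS ZS; have gYS := smooth_sectZ gS YS.
rewrite bracket_antisym //; last exact: smooth_sect_lin.
rewrite (_ : (fun y => _) = (fun y => 1 *: (g y *: Y y) + Z y)); last first.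
  by apply/functional_extensionality_dep => y; rewrite scale1r.
rewrite bracket_linear // scale1r opprD -!bracket_antisym //.
by rewrite bracket_leibniz.
Qed.

Lemma bracket_linl V g Y Z x : smooth g ->
  smooth_sect V -> smooth_sect Y -> smooth_sect Z ->
  bracket (fun y => g y *: Y y + Z y) V x
  = g x *: bracket Y V x - anchor (V x) g *: Y x + bracket Z V x.
Proof.
move=> gS VS YS ZS; rewrite bracket_antisym //; last exact: smooth_sect_lin.
by rewrite bracket_linr // !opprD -scalerN -!bracket_antisym.
Qed.

Lemma ext_smooth x (v : A x) : smooth_sect (ext v).
Proof. by have [] := @xgetPex _ (fun y => 0) _ (smooth_sect_through v). Qed.

Lemma extE x (v : A x) : ext v x = v.
Proof. by have [] := @xgetPex _ (fun y => 0) _ (smooth_sect_through v). Qed.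

(** Made for trivialized densities, which are forms only where their frame is a basis; the test
    sections stay global. *)
Definition is_form_on (U : set M) k (alpha : form_field A k) :=
  (forall y, U y -> alternating (alpha y)) /\
  (forall X : 'I_k -> sect A, (forall i, smooth_sect (X i)) ->
    smooth_on U (fun y => alpha y (fun i => X i y))).

Lemma is_form_onT k (alpha : form_field A k) :
  is_form alpha <-> is_form_on setT alpha.
Proof. by split=> -[aA aS]; split => // y *; apply: aA. Qed.

(** The predicate [c] selects the slots that are bracketed with [V]: those after the place of [V]
    give a summand of the Koszul formula, all of them give the Lie derivative along [V]. *)
Definition koszul_term k (alpha : form_field A k) V (S : 'I_k -> sect A)
    (c : pred 'I_k) (x : M) : R :=
  anchor (V x) (fun y => alpha y (fun l => S l y))
  - \sum_(j | c j) alpha x (upd (fun l => S l x) j (bracket V (S j) x)).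

Definition koszul k (alpha : form_field A k) (X : 'I_k.+1 -> sect A) (x : M) : R :=
  \sum_(i < k.+1) (-1) ^+ i * koszul_term alpha (X i) (fun l => X (lift i l))
                                (fun j => (i < lift i j)%N) x.

Lemma dA_koszul k (alpha : form_field A k) x (v : 'I_k.+1 -> A x) :
  dA alpha v = koszul alpha (fun i => ext (v i)) x.
Proof.
apply: eq_bigr => i _; rewrite /koszul_term extE; congr (_ * (_ - _)).
apply: eq_bigr => j _; congr (alpha x (upd _ _ _)).
by apply/funext => l; rewrite extE.
Qed.

Section LocalForm.
Context {U : set M} {k : nat} {alpha : form_field A k}.
Arguments alpha : clear implicits.
Hypotheses (Uo : open U) (aF : is_form_on U alpha).
Context {x : M}.
Hypothesis Ux : U x.

Lemma form_smooth_near (S : 'I_k -> sect A) : (forall l, smooth_sect (S l)) ->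
  smooth_near x (fun y => alpha y (fun l => S l y)).
Proof. by move=> SS; exists U; split => //; exact: aF.2. Qed.

Lemma smooth_sect_upd n (S : 'I_n -> sect A) p W :
  (forall l, smooth_sect (S l)) -> smooth_sect W ->
  forall l, smooth_sect (upd S p W l).
Proof. by move=> SS WS l; rewrite /upd; case: ifP. Qed.

Lemma eval_upd n (S : 'I_n -> sect A) p W y :
  (fun l => upd S p W l y) = upd (fun l => S l y) p (W y).
Proof. exact: (map_upd (fun Z : sect A => Z y)). Qed.

Lemma koszul_term_linl g Y Z (S : 'I_k -> sect A) c :
  smooth g -> smooth_sect Y -> smooth_sect Z -> (forall l, smooth_sect (S l)) ->
  koszul_term alpha (fun y => g y *: Y y + Z y) S c x
  = g x * koszul_term alpha Y S c x + koszul_term alpha Z S c x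
    + \sum_(j | c j) anchor (S j x) g * alpha x (upd (fun l => S l x) j (Y x)).
Proof.
move=> gS YS ZS SS; have aL := alternating_multilin (aF.1 x Ux).
rewrite /koszul_term anchor_linear; last exact: form_smooth_near.
have -> : \sum_(j | c j) alpha x (upd (fun l => S l x) j
                          (bracket (fun y => g y *: Y y + Z y) (S j) x))
    = g x * (\sum_(j | c j) alpha x (upd (fun l => S l x) j (bracket Y (S j) x)))
      - \sum_(j | c j) anchor (S j x) g * alpha x (upd (fun l => S l x) j (Y x))
      + \sum_(j | c j) alpha x (upd (fun l => S l x) j (bracket Z (S j) x)).
  rewrite mulr_sumr -sumrB -big_split; apply: eq_bigr => j _ /=.
  rewrite bracket_linl // (multilinD aL) (multilinD aL) (multilinZ aL).
  by rewrite -scaleNr (multilinZ aL) mulNr.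
ring.
Qed.

(** [V(g)] arises when the anchor differentiates the coefficient of slot [p], and once more with the
    opposite sign in [[V, g Y]] when [c] selects [p]. *)
Lemma koszul_term_linr V g Y Z (S : 'I_k -> sect A) p c :
  smooth_sect V ->
  smooth g -> smooth_sect Y -> smooth_sect Z -> (forall l, smooth_sect (S l)) ->
  koszul_term alpha V (upd S p (fun y => g y *: Y y + Z y)) c x
  = g x * koszul_term alpha V (upd S p Y) c x
    + koszul_term alpha V (upd S p Z) c x
    + (if c p then 0
       else anchor (V x) g * alpha x (upd (fun l => S l x) p (Y x))).
Proof.
move=> VS gS YS ZS SS; have aL := alternating_multilin (aF.1 x Ux).
set W := (fun y => _).
have YF := form_smooth_near (smooth_sect_upd p SS YS).
have ZF := form_smooth_near (smooth_sect_upd p SS ZS).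
have gF := smooth_smooth_near x gS.
have T := anchor_tangent (V x).
have anchorW : anchor (V x) (fun y => alpha y (fun l => upd S p W l y))
    = g x * anchor (V x) (fun y => alpha y (fun l => upd S p Y l y))
      + anchor (V x) g * alpha x (upd (fun l => S l x) p (Y x))
      + anchor (V x) (fun y => alpha y (fun l => upd S p Z l y)).
  rewrite -eval_upd -(tangentM T gF YF) -(tangentD T (smooth_nearM gF YF) ZF).
  apply/esym/(tangent_congr T Uo Ux); last exact/smooth_nearD/ZF/smooth_nearM.
  by move=> y Uy; rewrite !eval_upd (aF.1 y Uy).1.
rewrite /koszul_term anchorW.
have sumW : \sum_(j | c j) alpha x (upd (fun l => upd S p W l x) j
                                     (bracket V (upd S p W j) x))
    = g x * (\sum_(j | c j) alpha x (upd (fun l => upd S p Y l x) j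
                                     (bracket V (upd S p Y j) x)))
      + \sum_(j | c j) alpha x (upd (fun l => upd S p Z l x) j
                                     (bracket V (upd S p Z j) x))
      + (if c p then anchor (V x) g * alpha x (upd (fun l => S l x) p (Y x))
         else 0).
  have -> : (if c p then anchor (V x) g * alpha x (upd (fun l => S l x) p (Y x))
         else 0) = \sum_(j | c j) (if j == p then
            anchor (V x) g * alpha x (upd (fun l => S l x) p (Y x)) else 0).
    case: ifPn => cp.
      rewrite (bigD1 p) //= eqxx big1 ?addr0 // => j /andP[_ /negPf ->] //.
    by rewrite big1 // => j cj; case: eqP => // jp; rewrite -jp cj in cp.
  rewrite mulr_sumr -!big_split; apply: eq_bigr => j _ /=; rewrite !eval_upd.
  have [->|jp] := eqVneq j p.
    rewrite !upd_at !upd_upd bracket_linr //.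
    rewrite !(multilinD aL) !(multilinZ aL); ring.
  rewrite !(upd_off _ _ jp) !(upd_comm _ _ _ (_ : p != j)) 1?eq_sym //.
  by rewrite aL addr0.
by rewrite sumW; case: ifP => _; ring.
Qed.

End LocalForm.

Section LocalFormS.
Context {U : set M} {k : nat} {alpha : form_field A k}.
Arguments alpha : clear implicits.
Hypotheses (Uo : open U) (aF : is_form_on U alpha).
Context {x : M}.
Hypothesis Ux : U x.

Lemma koszul_lin g Y Z (X : 'I_k.+1 -> sect A) p :
  smooth g -> smooth_sect Y -> smooth_sect Z -> (forall l, smooth_sect (X l)) ->
  koszul alpha (upd X p (fun y => g y *: Y y + Z y)) x
  = g x * koszul alpha (upd X p Y) x + koszul alpha (upd X p Z) x.
Proof.
move=> gS YS ZS XS; set W := (fun y => _).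
(* [E i] is the failure of the [i]-th term to be linear over functions. The [j]-th summand of [E p]
   is matched with [E (lift p j)], and each pair cancels by [alt_lift]. *)
pose E (i : 'I_k.+1) : R := if i == p then
    \sum_(j < k | (p < lift p j)%N) anchor (X (lift p j) x) g
      * alpha x (upd (fun l => X (lift p l) x) j (Y x))
  else if (p < i)%N then
    anchor (X i x) g * alpha x (fun l => upd (fun l => X l x) p (Y x) (lift i l))
  else 0.
have termE i : koszul_term alpha (upd X p W i) (fun l => upd X p W (lift i l))
      (fun j => (i < lift i j)%N) x
    = g x * koszul_term alpha (upd X p Y i) (fun l => upd X p Y (lift i l))
        (fun j => (i < lift i j)%N) x
      + koszul_term alpha (upd X p Z i) (fun l => upd X p Z (lift i l))
        (fun j => (i < lift i j)%N) x + E i.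
  rewrite /E; have [->|ip] := eqVneq i p.
    by rewrite !upd_at !upd_lift_at (koszul_term_linl Uo aF Ux).
  have [p' pE _] := unlift_some ip; rewrite pE.
  have ni := neq_lift i p'; rewrite !(upd_off _ _ ni) !upd_lift.
  rewrite (koszul_term_linr Uo aF Ux) //; congr (_ + _).
  by case: ltngtP ni => // /val_inj <-; rewrite eqxx.
rewrite /koszul; under eq_bigr => i _ do rewrite termE mulrDr mulrDr mulrCA.
rewrite !big_split /= -mulr_sumr -[RHS]addr0; congr (_ + _).
rewrite (bigD1_ord p) //= {1}/E eqxx big_mkcond mulr_sumr -big_split big1 //=.
move=> j _; rewrite /E eq_sym (negPf (neq_lift p j)).
case: ifP => _; last by rewrite !mulr0 addr0.
have := alt_lift (fun l => X l x) (Y x) (aF.1 x Ux) (neq_lift p j).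
rewrite upd_lift => e; rewrite mulrCA [X in _ + X]mulrCA -mulrDr.
by rewrite e mulr0.
Qed.

(** Write [X p = (1 - b^2) X p + \sum_j (b X_j) (b e_j)], with [X_j] the coordinates of [X p] in the
    frame [e]: every coefficient is globally smooth and vanishes at [x], because [b x = 1] and
    [X p x = 0]. *)
Lemma koszul_eq0 (X : 'I_k.+1 -> sect A) p :
  (forall l, smooth_sect (X l)) -> X p x = 0 -> koszul alpha X x = 0.
Proof.
move=> XS Xp0; pose K W := koszul alpha (upd X p W) x.
have K0 : K (fun y => 0) = 0.
  have S0 := @smooth_sect0 _ _ _ _ A.
  have := @koszul_lin (fun=> 1) _ _ X p (smooth_on_cst 1 openT) S0 S0 XS.
  rewrite (_ : (fun y => _) = (fun y => 0)); last first.
    by apply/functional_extensionality_dep => y; rewrite scaler0 addr0.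
  by rewrite mul1r -/(K _) => /eqP; rewrite -subr_eq subrr eq_sym => /eqP.
have [e eF ex] := frame_cover A x.
have [b [bS bx bs]] := bump_exists (frame_open eF) ex.
pose c j y := b y * coord (e y) j (X p y).
have cS j : smooth (c j).
  apply: (smooth_on_bumpM (frame_open eF) openT bS bs).
  by rewrite setTI; exact: XS.
have FS j := frame_sect_smooth j eF bS bs.
have Ksum (s : seq 'I_r) :
    K (fun y => \sum_(j <- s) c j y *: frame_sect e b j y) = 0.
  elim: s => [|j s IHs].
    rewrite (_ : (fun y => _) = (fun y => 0)) //.
    by apply/functional_extensionality_dep => y; rewrite big_nil.
  rewrite (_ : (fun y => _) = (fun y => c j y *: frame_sect e b j y
      + \sum_(j <- s) c j y *: frame_sect e b j y)); last first.
    by apply/functional_extensionality_dep => y; rewrite big_cons.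
  rewrite /K koszul_lin //; last exact: smooth_sect_sum.
  by rewrite -!/(K _) IHs addr0 /c Xp0 linear0 !mulr0 mul0r.
rewrite -(upd_id X p) (_ : X p = (fun y => (1 + -1 * (b y * b y)) *: X p y
    + \sum_j c j y *: frame_sect e b j y)); last first.
  apply/functional_extensionality_dep => y; rewrite -(bump_sq_expand _ _ eF bs).
  by rewrite -scalerDl mulN1r subrK scale1r.
rewrite koszul_lin //; last first.
- exact: smooth_sect_sum.
- apply: smooth_onD; [exact: openT|exact/smooth_on_cst/openT|].
  apply: (smooth_onM openT); first exact/smooth_on_cst/openT.
  exact: smooth_onM openT _ _.
by rewrite -!/(K _) Ksum bx mulr1 mulN1r subrr mul0r addr0.
Qed.

Lemma koszul_tensorial (X Y : 'I_k.+1 -> sect A) :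
  (forall l, smooth_sect (X l)) -> (forall l, smooth_sect (Y l)) ->
  (forall l, X l x = Y l x) -> koszul alpha X x = koszul alpha Y x.
Proof.
move=> XS YS XY; pose Z t (l : 'I_k.+1) := if (l < t)%N then Y l else X l.
have ZS t l : smooth_sect (Z t l) by rewrite /Z; case: ifP.
have ZX : Z 0%N = X by [].
have ZY : Z k.+1 = Y by apply/funext => l; rewrite /Z ltn_ord.
rewrite -ZX -ZY; elim: {-2}k.+1 (leqnn k.+1) => // t IHt tk.
rewrite IHt ?(ltnW tk) //; pose p := Ordinal tk.
have -> : Z t.+1 = upd (Z t) p (fun y => 1 *: (Y p y + - 1 *: X p y) + Z t p y).
  apply/funext => l; rewrite /upd /Z ltnS leq_eqVlt -(inj_eq val_inj) /=.
  have [e|//] := eqVneq (l : nat) t; rewrite ltnn (_ : l = p); last exact/val_inj.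
  apply/functional_extensionality_dep => y.
  by rewrite scale1r scaleN1r subrK.
have YXS : smooth_sect (fun y => Y p y + -1 *: X p y).
  have := smooth_sect_lin (smooth_on_cst (-1) openT) (XS p) (YS p).
  rewrite (_ : (fun y => _) = (fun y => Y p y + -1 *: X p y)) //.
  by apply/functional_extensionality_dep => y; rewrite addrC.
rewrite koszul_lin //; last exact/smooth_on_cst/openT.
rewrite mul1r upd_id [X in X + _](@koszul_eq0 _ p) ?add0r //.
  exact: smooth_sect_upd.
by rewrite upd_at XY scaleN1r subrr.
Qed.

Lemma dA_sect (X : 'I_k.+1 -> sect A) : (forall l, smooth_sect (X l)) ->
  dA alpha (fun l => X l x) = koszul alpha X x.
Proof.
move=> XS; rewrite dA_koszul; apply: koszul_tensorial => // l.
  exact: ext_smooth.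
by rewrite extE.
Qed.

End LocalFormS.

Lemma iota_form_on U k (alpha : form_field A k.+1) X :
  is_form_on U alpha -> smooth_sect X -> is_form_on U (@iota _ _ _ _ A X k alpha).
Proof.
move=> [aA aS] XS; split.
  move=> y Uy; have [aL a0] := aA y Uy; split.
    exact: (multilin_insert ord0 (X y) aL).
  move=> v i j ij vij; apply: (a0 _ (lift ord0 i) (lift ord0 j)).
    by rewrite (inj_eq (@lift_inj _ _)).
  by rewrite /vcons !liftK.
move=> S SS; have := aS (vcons X S).
rewrite (_ : (fun y => alpha y _) = (fun y => iota X alpha (fun l => S l y))).
  by apply=> i; rewrite /vcons; case: (unlift _ i).
apply/funext => y; congr (alpha y _).
exact: (map_insert (fun Z : sect A => Z y) ord0 X S).
Qed.

(* Cartan's formula [L_X = i_X d + d i_X] in the form of the Leibniz rule. *)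
Lemma lie_sect U k (alpha : form_field A k) X (V : 'I_k -> sect A) x :
  open U -> is_form_on U alpha -> U x -> smooth_sect X ->
  (forall l, smooth_sect (V l)) ->
  lie X alpha (fun l => V l x)
  = anchor (X x) (fun y => alpha y (fun l => V l y))
    - \sum_j alpha x (upd (fun l => V l x) j (bracket X (V j) x)).
Proof.
move=> Uo aF Ux XS VS.
have vconsS l : smooth_sect (vcons X V l).
  by rewrite /vcons; case: (unlift _ l).
have iotaE : iota X (dA alpha) (fun l => V l x)
    = koszul alpha (vcons X V) x.
  rewrite -(dA_sect Uo aF Ux vconsS); congr (dA alpha _).
  exact/esym/(map_insert (fun Z : sect A => Z x) ord0 X V).
have V0 : (fun l => vcons X V (lift ord0 l)) = V by exact: vcons_lift.
have head : koszul_term alpha (vcons X V ord0) (fun l => vcons X V (lift ord0 l))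
      (fun j => (@ord0 k < lift ord0 j)%N) x
    = anchor (X x) (fun y => alpha y (fun l => V l y))
    - \sum_j alpha x (upd (fun l => V l x) j (bracket X (V j) x)).
  by rewrite V0 vcons0 /koszul_term.
case: k => [|k] in alpha V aF VS vconsS iotaE V0 head * => /=.
  by rewrite iotaE /koszul big_ord_recl big_ord0 addr0 expr0 mul1r head.
have iF := iota_form_on aF XS.
rewrite iotaE (dA_sect Uo iF Ux VS) /koszul big_ord_recl expr0 mul1r head.
(* Beyond the head term, the term [i.+1] of [i_X d] and the term [i] of [d i_X] have the same value
   and opposite signs. *)
rewrite -addrA -big_split [X in _ + X]big1 ?addr0 // => i _.
rewrite -[LHS]/(_ + _) [in (-1) ^+ _]lift0 exprS mulN1r mulNr addrC -mulrBr.
rewrite (_ : _ - _ = 0) ?mulr0 //.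
have Vi : vcons X V (lift ord0 i) = V i by exact: (insert_lift ord0).
have lift2 (l : 'I_k) : lift (lift ord0 i) (lift ord0 l) = lift ord0 (lift i l).
  by apply/val_inj; rewrite /= /bump !add1n ltnS addnS.
have lift20 : lift (lift ord0 i) ord0 = ord0 by exact/val_inj.
have shift : (fun l => vcons X V (lift (lift ord0 i) l))
    = vcons X (fun l => V (lift i l)).
  apply/funext => l; case: (unliftP ord0 l) => [l'|] ->.
    by rewrite lift2 [LHS](insert_lift ord0) [RHS](insert_lift ord0).
  by rewrite lift20 !vcons0.
rewrite Vi shift /koszul_term.
have evalE y (S : 'I_k -> sect A) :
    (fun l => vcons X S l y) = vcons (X y) (fun l => S l y).
  exact: (map_insert (fun Z : sect A => Z y)).
apply/eqP; rewrite subr_eq0; apply/eqP; congr (_ - _).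
  by congr (anchor (V i x) _); apply/funext => y; rewrite evalE.
(* [X] occupies slot 0, which never comes after slot [i.+1], so no bracket with it occurs; the other
   slots agree up to a shift. *)
rewrite [RHS]big_mkcond big_ord_recl lift20 -[RHS]/(0 + _) add0r -big_mkcond.
apply: eq_big => [l|l _]; first by rewrite lift2 !lift0 ltnS.
rewrite evalE [vcons X _ (lift ord0 l)](insert_lift ord0) /iota.
by congr (alpha x _); exact: (insert_upd ord0).
Qed.

End Koszul.

(** * Products of 1-forms *)

Section Determinants.
Context {R : realType}.

(** The determinant as a function of its rows, so that the results on alternating functions apply to
    it. *)
Definition det_rows m (w : 'I_m -> 'rV[R]_m) : R := \det (\matrix_(i, j) w i 0 j).

Lemma det_rows_alt m : alternating (@det_rows m).
Proof.
split.
  move=> w i a u v; rewrite /det_rows.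
  rewrite (@determinant_multilinear _ _ _ (\matrix_(l, j) upd w i u l 0 j)
    (\matrix_(l, j) upd w i v l 0 j) i a 1) ?mul1r //.
  - by apply/rowP => j; rewrite !mxE !upd_at !mxE mul1r.
  - by apply/matrixP => l j; rewrite !mxE !upd_off // eq_sym neq_lift.
  - by apply/matrixP => l j; rewrite !mxE !upd_off // eq_sym neq_lift.
move=> w i j ij wij; apply: (determinant_alternate ij) => l.
by rewrite !mxE wij.
Qed.

Lemma tangent_det d (M : manifold R d) (x : M) (D : (M -> R) -> R) m
    (F : 'I_m -> M -> 'rV[R]_m) :
  tangent x D -> (forall l a, smooth_near x (fun y => F l y 0 a)) ->
  D (fun y => det_rows (fun l => F l y))
  = \sum_j det_rows (upd (fun l => F l x) j (\row_a D (fun y => F j y 0 a))).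
Proof.
move=> DT FS.
rewrite (_ : (fun y => _) = (fun y => \sum_(s : 'S_m) (-1) ^+ s *
    \prod_l F l y 0 (s l))); last first.
  apply/funext => y; apply: eq_bigr => s _; congr (_ * _).
  by apply: eq_bigr => l _; rewrite mxE.
rewrite (tangent_sum DT) => [|s]; last first.
  apply: smooth_nearM; first exact: smooth_near_cst.
  by apply: smooth_near_prod.
rewrite [RHS]exchange_big; apply: eq_bigr => s _ /=.
rewrite (tangentZ DT); last exact: smooth_near_prod.
rewrite (tangent_prod DT) // mulr_sumr; apply: eq_bigr => j _; congr (_ * _).
by apply: eq_bigr => l _; rewrite mxE /upd; case: eqP => // ->; rewrite mxE.
Qed.

Lemma multilin_scale (V : lmodType R) k (f : ('I_k -> V) -> R) c v :
  multilinear f -> f (fun l => c *: v l) = c ^+ k * f v.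
Proof.
elim: k f v => [|k IHk] f v fL.
  by rewrite mul1r; congr f; apply/funext => -[].
rewrite -(insert_id ord0 (fun l => c *: v l)) -(upd_insert _ 0) (multilinZ fL).
rewrite upd_insert (IHk _ (fun l => v (lift ord0 l)) (multilin_insert _ _ fL)).
by rewrite insert_id mulrA -exprS.
Qed.

(** The expansion of [f] over products of dual basis vectors, with each increasing multi-index
    counted [k!] times: every permutation in the determinant contributes [f v]. *)
Lemma top_form_sum (V : vectType R) n k (b : n.-tuple V) (f : ('I_k -> V) -> R) v :
  basis_of {: V} b -> alternating f ->
  \sum_(g : {ffun 'I_k -> 'I_n}) f (fun l => tnth b (g l))
    * \det (\matrix_(i, j) coord b (g i) (v j)) = k`!%:R * f v.
Proof.
move=> bB fA; have fL := alternating_multilin fA.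
under eq_bigr => g _ do rewrite /determinant mulr_sumr.
rewrite exchange_big /= -[X in _ = X%:R * _]card_Sn -sumr_const mulr_suml.
apply: eq_bigr => s _; transitivity ((-1) ^+ s * f (v \o s)).
  rewrite (multilin_basis (v \o s) bB fL) mulr_sumr; apply: eq_bigr => g _.
  rewrite mulrCA; congr (_ * _); rewrite mulrC; congr (_ * _).
  by apply: eq_bigr => i _; rewrite mxE.
by rewrite (alt_perm fA) mulrA -signr_addb addbb.
Qed.

(** Packs a covector such as [u |-> anchor u g] into [dual], as [contract_wedge] requires. *)
Lemma dual_of_linear (V : vectType R) (phi : V -> R) :
  (forall a u w, phi (a *: u + w) = a * phi u + phi w) ->
  exists xi : dual V, forall u, xi u = phi u :> R.
Proof.
move=> phiL; pose b := vbasis {: V}.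
have phi0 : phi 0 = 0.
  have := phiL 1 0 0; rewrite scale1r addr0 mul1r => /eqP.
  by rewrite -subr_eq subrr eq_sym => /eqP.
exists (\sum_i phi (tnth b i) *: cobasis b i) => u.
rewrite sum_lfunE [in RHS](basis_sum u (vbasisP fullv)) -/b.
apply: (big_rec2 (fun y z => y = phi z)) => // i y z _ ->.
by rewrite phiL scale_lfunE cobasisE mulrC.
Qed.

End Determinants.

Section OneForms.
Context {R : realType} {d : nat} {M : manifold R d} {r : nat}.
Context {A : lie_algebroid M r}.
Implicit Types (X Y Z V W : sect A) (f g : M -> R) (x : M).

Lemma dfunE f x (v : 'I_1 -> A x) : dfun f v = anchor (v ord0) f.
Proof.
by rewrite /dfun /dA big_ord_recl big_ord0 big_ord0 expr0 mul1r subr0 addr0.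
Qed.

Lemma anchorP x f : smooth_near x f -> forall a (u w : A x),
  anchor (a *: u + w) f = a * anchor u f + anchor w f.
Proof. by move=> fS a u w; exact: anchor_linear. Qed.

Lemma dfun_form f : smooth f -> is_form (dfun (A := A) f).
Proof.
move=> fS; split.
  move=> x; split=> [v i a u w|v i j]; last by rewrite (ord1 i) (ord1 j) eqxx.
  rewrite !dfunE (ord1 i) !upd_at anchorP //; exact: smooth_smooth_near.
move=> X XS; rewrite (_ : (fun x => _) = (fun x => anchor (X ord0 x) f)).
  exact: anchor_smooth.
by apply/funext => x; rewrite dfunE.
Qed.

Lemma form1_linear (V : lmodType R) (phi : ('I_1 -> V) -> R) a u w :
  alternating phi -> phi (fun=> a *: u + w) = a * phi (fun=> u) + phi (fun=> w).
Proof.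
move=> [pL _]; have E (z : V) : (fun _ : 'I_1 => z) = upd (fun=> 0) ord0 z.
  by apply/funext => i; rewrite (ord1 i) upd_at.
by rewrite (E (_ + _)) (E u) (E w) pL.
Qed.

Lemma wedge1_rows m (xi : 'I_m -> form_field A 1) x (v : 'I_m -> A x) :
  wedge1 xi v = det_rows (fun j => \row_i xi i x (fun=> v j)).
Proof.
rewrite /wedge1 -det_tr /det_rows; congr (\det _).
by apply/matrixP => i j; rewrite !mxE.
Qed.

Lemma wedge1_alt m (xi : 'I_m -> form_field A 1) x :
  (forall i, alternating (xi i x)) -> alternating (wedge1 xi (x := x)).
Proof.
move=> xiA; have [dL d0] := @det_rows_alt R m; split.
  move=> v i a u w; rewrite !wedge1_rows.
  have E z : (fun j => \row_a xi a x (fun=> upd v i z j))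
      = upd (fun j => \row_a xi a x (fun=> v j)) i (\row_a xi a x (fun=> z)).
    exact: (map_upd (fun u => \row_a xi a x (fun=> u))).
  rewrite !E -dL; congr (det_rows (upd _ _ _)).
  by apply/rowP => b; rewrite !mxE form1_linear.
by move=> v i j ij vij; rewrite wedge1_rows; apply: (d0 _ i j ij); rewrite vij.
Qed.

Lemma wedge1_form m (xi : 'I_m -> form_field A 1) :
  (forall i, is_form (xi i)) -> is_form (wedge1 xi).
Proof.
move=> xiF; split=> [x|X XS]; first by apply: wedge1_alt => i; exact: (xiF i).1.
apply: smooth_on_sum; first exact: openT.
move=> s _; apply: smooth_onM; [exact: openT|exact/smooth_on_cst/openT|].
apply: smooth_on_prod; first exact: openT.
move=> i _; under eq_fun do rewrite mxE.
exact: ((xiF i).2 (fun=> X (s i))).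
Qed.

Lemma wedge1_exact_closed m (f : 'I_m -> M -> R) x (v : 'I_m.+1 -> A x) :
  (forall i, smooth (f i)) -> dA (wedge1 (fun i => dfun (A := A) (f i))) v = 0.
Proof.
move=> fS; rewrite dA_koszul; set V := fun i => ext (v i).
have VS i : smooth_sect (V i) by exact: ext_smooth.
pose h y (u : A y) : 'rV[R]_m := \row_a anchor u (f a).
have WE y (w : 'I_m -> A y) :
    wedge1 (fun i => dfun (A := A) (f i)) w = det_rows (fun l => h y (w l)).
  rewrite wedge1_rows; congr det_rows; apply/funext => l.
  by apply/rowP => a; rewrite !mxE dfunE.
pose H i q : 'rV[R]_m := \row_a anchor (V i x) (fun y => anchor (V q y) (f a)).
(* The row [H i q] holds the second derivatives [V_i(V_q(f_a))] at [x]; the row of a bracket is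
   [H i q - H q i]. *)
pose w l := h x (V l x).
pose B (i q : 'I_m.+1) u := det_rows (fun l => upd w q u (lift i l)).
have [dL _] := @det_rows_alt R m.
have termE i : koszul_term (wedge1 (fun i => dfun (A := A) (f i))) (V i)
      (fun l => V (lift i l)) (fun j => (i < lift i j)%N) x
    = \sum_(j < m) (if (i < lift i j)%N then B i (lift i j) (H (lift i j) i)
                    else B i (lift i j) (H i (lift i j))).
  rewrite /koszul_term.
  rewrite (_ : (fun y => _) = (fun y => det_rows (fun l => h y (V (lift i l) y))));
    last by apply/funext => y; rewrite WE.
  rewrite (tangent_det (anchor_tangent (V i x))) => [|l a]; last first.
    rewrite (_ : (fun y => _) = (fun y => anchor (V (lift i l) y) (f a))).
      exact/smooth_smooth_near/anchor_smooth.
    by apply/funext => y; rewrite mxE.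
  rewrite [X in _ - X]big_mkcond -sumrB; apply: eq_bigr => j _.
  have -> : \row_a anchor (V i x) (fun y => h y (V (lift i j) y) 0 a)
      = H i (lift i j).
    apply/rowP => a; rewrite !mxE; congr (anchor _ _).
    by apply/funext => y; rewrite mxE.
  rewrite /B !upd_lift; case: ifP => _; last by rewrite subr0.
  have brE : h x (bracket (V i) (V (lift i j)) x)
      = H i (lift i j) - H (lift i j) i.
    by apply/rowP => a; rewrite !mxE anchor_bracket.
  rewrite WE (map_upd (h x)) brE.
  rewrite -[X in det_rows (upd _ j X) - _](subrK (H (lift i j) i)).
  by rewrite (multilinD dL) addrAC subrr add0r.
(* For [i < q] the bracket exchanges [H i q] for [H q i]. So [G i q] and [G q i] contain the same
   row of second derivatives and are opposite by [alt_lift]; an antisymmetric double sum is zero. *)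
pose G (i q : 'I_m.+1) : R := (-1) ^+ i * (if q == i then 0 else
  if (i < q)%N then B i q (H q i) else B i q (H i q)).
transitivity (\sum_i \sum_q G i q).
  apply: eq_bigr => i _; rewrite termE (bigD1_ord i) //= {1}/G eqxx mulr0 add0r.
  rewrite mulr_sumr; apply: eq_bigr => j _.
  by rewrite /G eq_sym (negPf (neq_lift i j)).
have GN i q : G i q = - G q i.
  apply/eqP; rewrite -addr_eq0 /G.
  have [->|iq] := eqVneq i q; first by rewrite mulr0 addr0.
  have qi : q != i by rewrite eq_sym.
  case: ltngtP => [_|_|/val_inj e]; last by rewrite e eqxx in iq.
    by rewrite alt_lift //; exact: det_rows_alt.
  by rewrite addrC alt_lift //; exact: det_rows_alt.
have : \sum_i \sum_q G i q = - \sum_i \sum_q G i q.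
  rewrite {1}exchange_big -sumrN; apply: eq_bigr => i _.
  by rewrite -sumrN; apply: eq_bigr => q _; exact: GN.
by move/eqP; rewrite -addr_eq0 -mulr2n mulrn_eq0 => /eqP.
Qed.

End OneForms.

(** * The modular tensor *)

Section Nambu.
Context {R : realType} {d : nat} {M : manifold R d} {r : nat}.
Context {A : lie_algebroid M r}.
Implicit Types (X Y Z V W : sect A) (f g : M -> R) (x : M).

Lemma smooth_continuous f : smooth f -> continuous f.
Proof.
move=> fS x; have [c ac cx] := atlas_cover x.
have fc : {for cmap c x, continuous (f \o cinv c)}.
  by have [fc _] := fS c ac 0%N; apply: fc; split; [exact: cmap_img|].
have := continuous_comp (cmap_continuous cx) fc.
rewrite /prop_for /continuous_at /= cmapK // => fcc.
apply: cvg_trans fcc; apply: near_eq_cvg.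
apply: filterS (open_nbhs_nbhs (conj (@cdom_open _ _ _ c) cx)) => y cy /=.
by rewrite cmapK.
Qed.

Lemma smooth_neq0_open f : smooth f -> open [set y | f y != 0].
Proof.
move=> /smooth_continuous fc; apply: (@open_comp _ _ f [set t | t != 0]).
  by move=> y _; exact: fc.
exact: open_neq.
Qed.

Definition frame_cosect (e : local_frame r A) (b : M -> R) (j : 'I_r) (y : M) :
  dual (A y) := b y *: cobasis (e y) j.

Lemma frame_cosectE e b j y (u : A y) :
  frame_cosect e b j y u = b y * coord (e y) j u :> R.
Proof. by rewrite scale_lfunE cobasisE. Qed.

Lemma frame_cosect_smooth e b j : frames e -> smooth b ->
  supported_in (fdom e) b -> smooth_cosect (frame_cosect e b j).
Proof.
move=> eF bS bs X XS; under eq_fun do rewrite frame_cosectE.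
apply: (smooth_on_bumpM (frame_open eF) openT bS bs).
by rewrite setTI; exact: XS.
Qed.

Section Sharp.
Context {m : nat} {Pi : multi_field A m.+1}.
Arguments Pi : clear implicits.
Hypothesis PiM : is_multisection Pi.

(** The coordinates are recomputed in the frame [e] by [contract_full]. Smoothness of [alpha] and
    [Pi] is only given on global sections, hence the cut-off frame and coframe, whose factors [b]
    are divided out where [b] is nonzero. *)
Lemma sharp_smooth (alpha : form_field A m) :
  is_form alpha -> smooth_sect (sharp_sect Pi alpha).
Proof.
move=> aF e eF i; apply: smooth_on_local => x ex.
have [b [bS bx bs]] := bump_exists (frame_open eF) ex.
pose W := fdom e `&` [set y | b y != 0].
have Wo : open W by apply: openI (frame_open eF) (smooth_neq0_open bS).
exists W; first by split => //=; rewrite bx oner_neq0.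
(* [b] enters [m] times through [alpha] and [m.+1] times through [Pi]. The index is written as a
   successor so that [log_family] is a negative power, not the logarithm. *)
pose F y := log_family (m + m.+1).-1.+1 (b y) * (m`!%:R^-1 *
  \sum_(g : {ffun 'I_m -> 'I_r}) alpha y (fun l => frame_sect e b (g l) y)
    * Pi y (fun l => vrcons (fun l => frame_cosect e b (g l))
                            (frame_cosect e b i) l y)).
have FS : smooth_on W F.
  apply: smooth_onM => //.
    by apply: smooth_on_log => //; [move=> y [_]|exact: smooth_smooth_on].
  apply: smooth_onM => //; first exact: smooth_on_cst.
  apply: smooth_on_sum => // g _; apply: smooth_onM => //.
    apply/smooth_smooth_on/aF.2 => l; exact: frame_sect_smooth.
  apply/smooth_smooth_on/PiM.2 => l.
  by rewrite /vrcons; case: (unlift _ l) => [l'|]; exact: frame_cosect_smooth.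
apply: smooth_on_congr FS => // y [ey /= by0].
have eB := frame_basis eF ey; have PiA := PiM.1 y; have aA := aF.1 y.
rewrite -[RHS]cobasisE (contract_sharp _ _ (alternating_multilin PiA)).
rewrite -[contract _ _](mulfK (_ : m`!%:R != 0)) ?pnatr_eq0 -?lt0n ?fact_gt0 //.
rewrite mulr_natr (contract_full eB aA (alternating_vrcons _ PiA)).
rewrite /F mulrCA mulrC; congr (_ / _); rewrite mulr_sumr; apply: eq_bigr => g _.
rewrite (multilin_scale _ _ (alternating_multilin aA)).
have -> : (fun l => vrcons (fun l => frame_cosect e b (g l))
                           (frame_cosect e b i) l y)
    = (fun l => b y *: vrcons (fun l => cobasis (e y) (g l)) (cobasis (e y) i) l).
  apply/funext => l; rewrite /vrcons; by case: (unlift _ l).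
rewrite (multilin_scale _ _ (alternating_multilin PiA)) mulrACA -exprD mulrA.
by rewrite /log_family prednK ?addnS // mulVf ?mul1r // expf_neq0.
Qed.

Lemma dA_lin k (alpha beta : form_field A k) g x (v : 'I_k.+1 -> A x) :
  is_form alpha -> is_form beta -> smooth g ->
  dA (fun y w => g y * alpha y w + beta y w) v
  = g x * dA alpha v + dA beta v
    + wedge_covector (fun u => anchor u g) (alpha x) v.
Proof.
move=> /is_form_onT aF /is_form_onT bF gS.
rewrite !dA_koszul /koszul mulr_sumr -!big_split /=; apply: eq_bigr => i _.
rewrite mulrCA -!mulrDr; congr (_ * _).
have VS l : smooth_sect (ext (v (lift i l))) by exact: ext_smooth.
have aN := form_smooth_near openT aF (x := x) I VS.
have bN := form_smooth_near openT bF (x := x) I VS.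
have gN := smooth_smooth_near x gS.
have T := anchor_tangent (ext (v i) x).
rewrite /koszul_term (tangentD T) //; last exact: smooth_nearM.
rewrite (tangentM T) // big_split -mulr_sumr /= extE.
rewrite (_ : (fun l => ext (v (lift i l)) x) = (fun l => v (lift i l))).
  ring.
by apply/funext => l; rewrite extE.
Qed.

(** The differential of [g alpha] has the extra term [dg /\ alpha], whose contraction is
    [(-1)^m X_alpha(g)] by [contract_wedge]; the prefactor [(-1)^(m+1)] leaves the sign [-1] in
    every order. *)
Lemma nambu_div_lin (alpha beta : form_field A m) g x :
  is_form alpha -> is_form beta -> smooth g ->
  nambu_div Pi (fun y w => g y * alpha y w + beta y w) x
  = g x * nambu_div Pi alpha x + nambu_div Pi beta x
    - anchor (sharp_sect Pi alpha x) g.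
Proof.
move=> aF bF gS; rewrite /nambu_div.
have -> : dA (fun y w => g y * alpha y w + beta y w) (x := x)
    = (fun v => 1 * (g x * dA alpha v + dA beta v)
       + wedge_covector (fun u => anchor u g) (alpha x) v).
  by apply/funext => v; rewrite dA_lin // mul1r.
have [xi xiE] := @dual_of_linear R (A x) (fun u => anchor u g)
  (anchorP (smooth_smooth_near x gS)).
rewrite !contract_linear (_ : (fun u : A x => anchor u g) = (fun u => xi u : R)).
  rewrite (contract_wedge _ (aF.1 x) (PiM.1 x)) xiE /sharp_sect !mul1r.
  have e : (-1) ^+ m * (-1) ^+ m = 1 :> R.
    by rewrite -exprD addnn -mul2n exprM sqrrN !expr1n.
  rewrite exprS mulN1r !mulNr mulrDr opprD [X in _ - X]mulrA e mul1r.
  by congr (_ - _); ring.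
by apply/funext => u; rewrite xiE.
Qed.

Section TopForm.
Context {U : set M} {w : form_field A r}.
Arguments w : clear implicits.
Hypotheses (Uo : open U) (wF : is_form_on U w).

Lemma lie_top_lin g X Y x (v : 'I_r -> A x) : U x ->
  smooth g -> smooth_sect X -> smooth_sect Y ->
  lie (fun y => g y *: X y + Y y) w v
  = g x * lie X w v + lie Y w v + anchor (X x) g * w x v.
Proof.
move=> Ux gS XS YS.
have VS l : smooth_sect (ext (v l)) by exact: ext_smooth.
have vE : v = (fun l => ext (v l) x) by apply/funext => l; rewrite extE.
have gXYS := smooth_sect_lin gS XS YS.
have lieE Z : smooth_sect Z ->
    lie Z w v = koszul_term w Z (fun l => ext (v l)) xpredT x.
  by move=> ZS; rewrite {1}vE (lie_sect Uo wF Ux ZS VS).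
rewrite !lieE // (koszul_term_linl Uo wF Ux) //; congr (_ + _).
have [e eF ex] := frame_cover A x.
have dgL := @anchorP _ _ _ _ A x g (smooth_smooth_near x gS).
(* The defect in [koszul_term_linl] sums [V_j(g)] times [w] with [X] in slot [j]; this is [X(g) w]
   since [dg /\ w = 0]. *)
rewrite -(top_form_wedge (X x) v (frame_basis eF ex) (wF.1 x Ux) dgL).
by rewrite -vE; apply: eq_bigr => j _; rewrite extE.
Qed.

Lemma lie_topM g X x (v : 'I_r -> A x) : U x -> smooth g -> smooth_sect X ->
  lie X (fun y u => g y * w y u) v = g x * lie X w v + anchor (X x) g * w x v.
Proof.
move=> Ux gS XS.
have VS l : smooth_sect (ext (v l)) by exact: ext_smooth.
have vE : v = (fun l => ext (v l) x) by apply/funext => l; rewrite extE.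
have gwF : is_form_on U (fun y u => g y * w y u).
  split=> [y Uy|S SS].
    have [wL w0] := wF.1 y Uy; split=> [u i a s t|u i j ij uij].
      by rewrite wL; ring.
    by rewrite (w0 u i j ij uij) mulr0.
  by apply: smooth_onM (smooth_smooth_on _ gS) (wF.2 S SS).
rewrite vE (lie_sect Uo gwF Ux XS VS) (lie_sect Uo wF Ux XS VS).
rewrite (tangentM (anchor_tangent _) (smooth_smooth_near x gS)); last first.
  exact: (form_smooth_near Uo wF Ux).
by rewrite -mulr_sumr; ring.
Qed.

(** The right-hand side of the equation for the modular tensor, with a local [r]-form [w] in place
    of the density. *)
Definition modular_form (alpha : form_field A m) : form_field A r :=
  fun x v => lie (sharp_sect Pi alpha) w v + nambu_div Pi alpha x * w x v.

(** With [X = Pi^# alpha], the terms [X(g) w] of [lie_top_lin] and [- X(g) w] of [nambu_div_lin]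
    cancel. *)
Lemma modular_form_lin (alpha beta : form_field A m) g x v : U x ->
  is_form alpha -> is_form beta -> smooth g ->
  modular_form (fun y u => g y * alpha y u + beta y u) v
  = g x * modular_form alpha v + @modular_form beta x v.
Proof.
move=> Ux aF bF gS; rewrite /modular_form nambu_div_lin //.
rewrite (_ : sharp_sect Pi _ = (fun y => g y *: sharp_sect Pi alpha y
    + sharp_sect Pi beta y)); last first.
  by apply/functional_extensionality_dep => y; exact: sharp_linear.
by rewrite lie_top_lin //; [ring|exact: sharp_smooth|exact: sharp_smooth].
Qed.

End TopForm.
End Sharp.
End Nambu.

(** * Vanishing of the modular form *)

Section Vanishing.
Context {R : realType} {d : nat} {M : manifold R d} {r : nat}.
Context {A : lie_algebroid M r} {m : nat} {Pi : multi_field A m.+1}.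
Arguments Pi : clear implicits.
Hypothesis PiM : is_multisection Pi.
Implicit Types (f g : M -> R) (x : M).

Lemma form_ext k (alpha beta : form_field A k) :
  (forall y u, alpha y u = beta y u) -> alpha = beta.
Proof.
move=> ab; apply/functional_extensionality_dep => y; apply/funext => u.
exact: ab.
Qed.

Lemma is_form_lin k (alpha beta : form_field A k) g :
  is_form alpha -> is_form beta -> smooth g ->
  is_form (fun y u => g y * alpha y u + beta y u).
Proof.
move=> [aA aS] [bA bS] gS; split=> [y|S SS].
  have [[aL a0] [bL b0]] := (aA y, bA y); split=> [u i c s t|u i j ij uij].
    by rewrite aL bL; ring.
  by rewrite (a0 u i j ij uij) (b0 u i j ij uij) mulr0 addr0.
apply: (smooth_onD openT _ (bS S SS)).
exact: (smooth_onM openT gS (aS S SS)).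
Qed.

Lemma is_form0 k : is_form ((fun y _ => 0) : form_field A k).
Proof.
split=> [y|S SS]; last exact/smooth_on_cst/openT.
by split=> // *; rewrite mulr0 addr0.
Qed.

Lemma smoothX f n : smooth f -> smooth (fun y => f y ^+ n).
Proof.
move=> fS; elim: n => [|n IHn]; first exact/smooth_on_cst/openT.
by under eq_fun do rewrite exprS; exact: smooth_onM openT fS IHn.
Qed.

Lemma nambu_div_exact (f : 'I_m -> M -> R) x : (forall i, smooth (f i)) ->
  nambu_div Pi (wedge1 (fun i => dfun (A := A) (f i))) x = 0.
Proof.
move=> fS; rewrite /nambu_div /contract big1 ?mulr0 // => I _.
by rewrite wedge1_exact_closed // mul0r.
Qed.

(** [c] will be the value at [y] of a bump function: the expansion of [xi p] is known only on an
    open set containing its support. *)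
Lemma wedge1_upd_sum (xi : 'I_m -> form_field A 1) p y (u : 'I_m -> A y) c
    (s : nat) (g : 'I_s -> R) (eta : 'I_s -> form_field A 1) :
  (c != 0 -> forall v, xi p y v = \sum_j g j * eta j y v) ->
  c * wedge1 xi u = \sum_j (c * g j) * wedge1 (upd xi p (eta j)) u.
Proof.
have [->|c0] := eqVneq c 0; first by rewrite mul0r big1 // => j _; rewrite !mul0r.
move=> /(_ isT) xiE.
have dL := alternating_multilin (@det_rows_alt R m).
pose row (z : form_field A 1) : 'rV[R]_m := \row_j z y (fun=> u j).
have WE z : wedge1 z u = det_rows (fun i => row (z i)).
  rewrite /wedge1 /det_rows; congr (\det _).
  by apply/matrixP => i j; rewrite !mxE.
rewrite WE -(upd_id (fun i => row (xi i)) p).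
rewrite (_ : row (xi p) = \sum_j g j *: row (eta j)); last first.
  apply/rowP => i; rewrite summxE mxE xiE.
  by apply: eq_bigr => j _; rewrite !mxE.
rewrite (multilin_sum dL) mulr_sumr; apply: eq_bigr => j _.
by rewrite (multilinZ dL) mulrA WE (map_upd row).
Qed.

Section Point.
Context {U : set M} {w : form_field A r}.
Arguments w : clear implicits.
Hypotheses (Uo : open U) (wF : is_form_on U w).
Context {x : M} {v : 'I_r -> A x}.
Hypothesis Ux : U x.

Let N (alpha : form_field A m) := modular_form (Pi := Pi) (w := w) alpha v.

Let N_lin alpha beta g : is_form alpha -> is_form beta -> smooth g ->
  N (fun y u => g y * alpha y u + beta y u) = g x * N alpha + N beta.
Proof. exact: (modular_form_lin PiM Uo wF). Qed.

Let N0 : N (fun y _ => 0) = 0.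
Proof.
have := N_lin (is_form0 m) (is_form0 m) (smooth_on_cst 1 openT).
have -> : (fun (y : M) (u : 'I_m -> A y) => (1 : R) * 0 + 0) = (fun y _ => 0).
  by apply: form_ext => y u; rewrite mulr0 addr0.
by rewrite mul1r => /eqP; rewrite -subr_eq subrr eq_sym => /eqP.
Qed.

Let NM alpha g : is_form alpha -> smooth g ->
  N (fun y u => g y * alpha y u) = g x * N alpha.
Proof.
move=> aF gS; rewrite -[RHS]addr0 -N0 -(N_lin aF (is_form0 m) gS).
by congr N; apply: form_ext => y u; rewrite addr0.
Qed.

Let N_sum0 (I : Type) (s : seq I) (g : I -> M -> R) (beta : I -> form_field A m) :
  (forall j, smooth (g j)) -> (forall j, is_form (beta j)) ->
  (forall j, N (beta j) = 0) -> N (fun y u => \sum_(j <- s) g j y * beta j y u) = 0.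
Proof.
move=> gS bF bN.
(* The induction also carries that the partial sums are forms, which [N_lin] asks of its second
   argument. *)
suff [_ //] : is_form (fun y u => \sum_(j <- s) g j y * beta j y u) /\
    N (fun y u => \sum_(j <- s) g j y * beta j y u) = 0.
elim: s => [|j s [IF IN]].
  rewrite (_ : (fun y u => _) = (fun y _ => 0)); first by split; [exact: is_form0|].
  by apply: form_ext => y u; rewrite big_nil.
rewrite (_ : (fun y u => _) = (fun y u => g j y * beta j y u
    + \sum_(j <- s) g j y * beta j y u)); last first.
  by apply: form_ext => y u; rewrite big_cons.
split; first exact: is_form_lin.
by rewrite N_lin // bN IN mulr0 addr0.
Qed.

Hypothesis gen : locally_generated_by_differentials A.
Hypothesis inv : forall f : 'I_m -> M -> R, (forall i, smooth (f i)) ->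
  lie (hamiltonian Pi f) w v = 0.

(* The factors are replaced by exact forms one at a time, after
   multiplication by a bump function at [x]. *)
Let N_wedge1 t (xi : 'I_m -> form_field A 1) : (t <= m)%N ->
  (forall i, is_form (xi i)) ->
  (forall i : 'I_m, (t <= i)%N -> exists f, smooth f /\ xi i = dfun f) ->
  N (wedge1 xi) = 0.
Proof.
elim: t xi => [|t IHt] xi tm xiF xi_exact.
  have /choice[f fP] : forall i, exists f, smooth f /\ xi i = dfun f.
    by move=> i; exact: xi_exact.
  rewrite (_ : xi = fun i => dfun (f i)); last first.
    by apply/funext => i; have [] := fP i.
  have fS i : smooth (f i) by have [] := fP i.
  by rewrite /N /modular_form nambu_div_exact // mul0r addr0; exact: inv.
pose p := Ordinal tm.
have [W [Wo Wx /(_ (xi p) (xiF p))[s [g [f [gS fS xiE]]]]]] := gen x.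
have [b [bS bx bs]] := bump_exists Wo Wx.
have -> : N (wedge1 xi) = N (fun y u => b y * wedge1 xi u).
  by rewrite NM ?bx ?mul1r //; exact: wedge1_form.
rewrite (_ : (fun y u => _) = (fun y u => \sum_(j < s) (b y * g j y) *
    wedge1 (upd xi p (dfun (f j))) u)); last first.
  apply: form_ext => y u; apply: wedge1_upd_sum => by0; apply: xiE.
  have [K [_ KW b0]] := bs; apply: KW; apply: contrapT => /b0 e.
  by rewrite e eqxx in by0.
have updF j i : is_form (upd xi p (dfun (f j)) i).
  by rewrite /upd; case: ifP => _; [exact: dfun_form|exact: xiF].
apply: N_sum0 => j.
- by apply: (smooth_on_bumpM Wo openT bS bs); rewrite setTI.
- by apply: wedge1_form.
(* Slot [t] now holds the differential of [f j], so all slots from [t] on are exact. *)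
apply: IHt => //; first exact: ltnW.
move=> i ti; rewrite /upd; case: eqP => [_|ip]; first by exists (f j).
apply: xi_exact; rewrite ltn_neqAle ti andbT; apply/eqP => e.
by apply: ip; exact/val_inj.
Qed.

(** The form [m! b^(2m) alpha] is a global combination of products of cut-off coframe elements: [m]
    factors [b] come from the arguments of [alpha], [m] from the coframe, and [m!] from summing over
    all multi-indices. At [x] the coefficient is [m!], which can be divided out. *)
Lemma modular_form_eq0 alpha : (0 < m)%N -> is_form alpha ->
  modular_form (Pi := Pi) (w := w) alpha v = 0.
Proof.
move=> m0 aF; have [e eF ex] := frame_cover A x.
have [b [bS bx bs]] := bump_exists (frame_open eF) ex.
pose theta j : form_field A 1 := fun y u => frame_cosect e b j y (u ord0).
have thetaF j : is_form (theta j).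
  split=> [y|X XS].
    split=> [u i c s t|u i i']; last by rewrite (ord1 i) (ord1 i') eqxx.
    by rewrite /theta (ord1 i) !upd_at linearP.
  by have H := @frame_cosect_smooth _ _ _ _ A e b j eF bS bs; exact: (H (X ord0)).
pose a (g : {ffun 'I_m -> 'I_r}) (y : M) := alpha y (fun l => frame_sect e b (g l) y).
have aS h : smooth (a h) by apply: aF.2 => l; exact: frame_sect_smooth.
have wF' (g : {ffun 'I_m -> 'I_r}) : is_form (wedge1 (fun i => theta (g i))).
  by apply: wedge1_form => i.
have S0 : N (fun y u => \sum_(h : {ffun 'I_m -> 'I_r})
    a h y * wedge1 (fun i => theta (h i)) u) = 0.
  (* For [t = m] no factor is assumed exact. *)
  apply: N_sum0 => // g; apply: (@N_wedge1 m) => // i mi.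
  by have := ltn_ord i; rewrite ltnNge mi.
pose c y := m`!%:R * b y ^+ (m + m).
have cS : smooth c.
  by apply: (smooth_onM openT); [exact/smooth_on_cst/openT|exact: smoothX].
apply/eqP; rewrite -(mulrI_eq0 _ (_ : GRing.lreg (c x))); last first.
  apply/lregP; rewrite /c bx expr1n mulr1 pnatr_eq0 -lt0n.
  exact: fact_gt0.
rewrite -/(N alpha) -(NM aF cS) -S0; apply/eqP; congr N.
apply: form_ext => y u; rewrite /c.
have aL := alternating_multilin (aF.1 y).
have wE (g : {ffun 'I_m -> 'I_r}) : wedge1 (fun i => theta (g i)) u
    = b y ^+ m * \det (\matrix_(i, j) coord (e y) (g i) (u j)).
  rewrite -detZ; congr (\det _); apply/matrixP => i j.
  by rewrite !mxE /theta frame_cosectE.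
under [RHS]eq_bigr => g _.
  rewrite wE /a (multilin_scale _ _ aL) mulrACA -exprD; over.
rewrite -mulr_sumr /=; have [K [_ KU b0]] := bs.
have [Ky|/b0 ->] := pselect (K y); last first.
  (* Where [b y = 0] the frame may not be a basis; both sides vanish there because the exponent
     [m + m] is positive. *)
  by rewrite expr0n addn_eq0 -leqn0 leqNgt m0 /= mulr0 !mul0r.
by rewrite (top_form_sum _ (frame_basis eF (KU _ Ky)) (aF.1 y)) mulrCA mulrA.
Qed.

End Point.
End Vanishing.

(** * Densities *)

Section Densities.
Context {R : realType} {d : nat} {M : manifold R d} {r : nat}.
Context {A : lie_algebroid M r}.
Implicit Types (f h : M -> R) (x : M) (mu nu : density_field A).

Lemma trivialized_form mu e : is_density mu -> frames e ->
  is_form_on (fdom e) (trivialized mu e).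
Proof.
move=> [muA _ muS _] eF; split=> [y ey|X XS]; last exact: muS.
exact/muA/(frame_basis eF ey).
Qed.

Lemma density_scale mu h : is_density mu -> smooth h -> (forall x, h x != 0) ->
  is_density (fun x b v => h x * mu x b v).
Proof.
move=> [muA muO muS muN] hS h0; split.
- move=> x b bB; have [aL a0] := muA x b bB; split=> [v i a u w|v i j ij vij].
    by rewrite aL; ring.
  by rewrite (a0 v i j ij vij) mulr0.
- by move=> x b b' bB b'B v; rewrite (muO x b b' bB b'B) mulrCA.
- move=> e eF X XS; apply: (smooth_onM (frame_open eF) (smooth_smooth_on _ hS)).
  exact: muS.
- move=> x b bB; have [v v0] := muN x b bB.
  by exists v; rewrite mulf_neq0.
Qed.

Lemma density_frame_neq0 mu x (b : r.-tuple (A x)) : is_density mu ->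
  basis_of {: A x} b -> mu x b (tnth b) != 0.
Proof.
move=> [muA _ _ muN] bB; have [v] := muN x b bB.
by rewrite (top_form_det v bB (muA x b bB)) mulf_eq0 => /norP[].
Qed.

(** Both densities change by the same sign with the basis, so their ratio, read off in one frame,
    holds in all bases. It is smooth because both can be evaluated on a cut-off frame, whose factor
    [b^r] disappears in the quotient. *)
Lemma density_ratio mu nu : is_density mu -> is_density nu ->
  exists h, [/\ smooth h, forall x, h x != 0 &
    forall x (b : r.-tuple (A x)), basis_of {: A x} b ->
      forall v, nu x b v = h x * mu x b v].
Proof.
move=> muD nuD; have [muA muO muS _] := muD; have [nuA nuO nuS _] := nuD.
have ratio_ex x : exists h : R,
    forall b : r.-tuple (A x), basis_of {: A x} b -> forall v, nu x b v = h * mu x b v.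
  have [e eF ex] := frame_cover A x; have eB := frame_basis eF ex.
  exists (nu x (e x) (tnth (e x)) / mu x (e x) (tnth (e x))) => b bB v.
  rewrite (muO x _ _ eB bB) (nuO x _ _ eB bB) [RHS]mulrCA; congr (_ * _).
  rewrite (top_form_det v eB (nuA x _ eB)) (top_form_det v eB (muA x _ eB)).
  by rewrite mulrCA divfK ?density_frame_neq0.
have /choice[h hE] := ratio_ex.
exists h; split => //; last first.
  move=> x; have [e eF ex] := frame_cover A x; have eB := frame_basis eF ex.
  have := density_frame_neq0 nuD eB; rewrite (hE x _ eB) mulf_eq0.
  by move=> /norP[].
apply: smooth_on_local => x _; have [e eF ex] := frame_cover A x.
have [b [bS bx bs]] := bump_exists (frame_open eF) ex.
pose E i := frame_sect e b i; have ES i : smooth_sect (E i) by exact: frame_sect_smooth.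
pose W := fdom e `&` [set y | b y != 0].
have Wo : open W by apply: openI (frame_open eF) (smooth_neq0_open bS).
exists W; first by split => //=; rewrite bx oner_neq0.
have muE0 y : W y -> trivialized mu e (fun i => E i y) != 0.
  move=> [ey /= by0]; have eB := frame_basis eF ey.
  rewrite /trivialized (multilin_scale _ _ (alternating_multilin (muA y _ eB))).
  by rewrite mulf_neq0 ?expf_neq0 ?density_frame_neq0.
have WS (la : density_field A) : is_density la ->
    smooth_on W (fun y => trivialized la e (fun i => E i y)).
  by move=> [_ _ laS _]; apply: smooth_on_sub (laS e eF E ES) => y [].
apply: smooth_on_congr (smooth_onM Wo (WS nu nuD)
  (smooth_onV Wo muE0 (WS mu muD))) => // y Wy.
have [ey _] := Wy; have eB := frame_basis eF ey.
by rewrite {1}/trivialized (hE y _ eB) mulfK //; exact: muE0.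
Qed.

Lemma lie_congr U k (w w' : form_field A k) X x (v : 'I_k -> A x) :
  open U -> is_form_on U w -> is_form_on U w' -> U x -> smooth_sect X ->
  (forall y, U y -> forall u, w y u = w' y u) -> lie X w v = lie X w' v.
Proof.
move=> Uo wF w'F Ux XS ww'.
have VS l : smooth_sect (ext (v l)) by exact: ext_smooth.
have -> : v = (fun l => ext (v l) x) by apply/funext => l; rewrite extE.
rewrite (lie_sect Uo wF Ux XS VS) (lie_sect Uo w'F Ux XS VS); congr (_ - _).
  apply: (tangent_congr (anchor_tangent _) Uo Ux) => [y Uy|].
    exact: ww'.
  exact: (form_smooth_near Uo wF Ux).
by apply: eq_bigr => j _; rewrite ww'.
Qed.

End Densities.

(** * The two implications *)

Theorem proposition4p11 (R : realType) (d r m : nat) (M : manifold R d)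
    (A : lie_algebroid M r) (Pi : multi_field A m.+1)
    (hn : (3 <= m.+1)%N) (hr : (m.+1 <= r)%N) (hPi : is_nambu Pi) :
  (modular_class_zero Pi ->
   exists mu : density_field A, is_density mu /\ hamiltonian_invariant Pi mu)
  /\
  (locally_generated_by_differentials A ->
   (exists mu : density_field A, is_density mu /\ hamiltonian_invariant Pi mu) ->
   modular_class_zero Pi).
Proof.
have [PiM _] := hPi; have m0 : (0 < m)%N by case: (m) hn.
split=> [H0|gen [mu [muD muI]]].
  (* The zero cochain lies in the coset on the right, hence in the modular class; unfolding this
     membership yields the density [mu], its tensor [T] and the function [f]. *)
  have : modular_class Pi (fun _ _ => 0).
    rewrite H0; split; last first.
      exists (fun=> 0); first exact/smooth_on_cst/openT.
      move=> alpha aF x; rewrite subrr /leib_action.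
      by rewrite (tangent_cst (anchor_tangent _)).
    split=> [alpha aF|a alpha beta aF bF x|alpha beta aF bF x].
    - exact/smooth_on_cst/openT.
    - by rewrite mulr0 addr0.
    - by rewrite /leib_action !(tangent_cst (anchor_tangent _)) subrr.
  move=> [mu [T [muD [_ muT] [_ [f fS fE]]]]].
  have fexpS : smooth (fun x => expR (f x)) by exact: smooth_on_exp openT fS.
  exists (fun x b v => expR (f x) * mu x b v); split.
    by apply: density_scale => // x; rewrite gt_eqF // expR_gt0.
  move=> g gS e eF x ex v; pose alpha := wedge1 (fun i => dfun (A := A) (g i)).
  have aF : is_form alpha by apply: wedge1_form => i; exact: dfun_form.
  have XS : smooth_sect (hamiltonian Pi g) by exact: sharp_smooth.
  have muF := trivialized_form muD eF; have eo := frame_open eF.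
  rewrite -[trivialized _ _]/(fun y u => expR (f y) * trivialized mu e u).
  rewrite (lie_topM eo muF) //.
  have := muT alpha aF e eF x ex v; rewrite nambu_div_exact // mul0r addr0 => <-.
  have := fE alpha aF x; rewrite sub0r /tensor_cochain => fxE.
  have fN := smooth_smooth_near x fS; have efN := smooth_smooth_near x fexpS.
  rewrite (tangent_comp (anchor_tangent _) fN efN (is_derive_expR (f x))).
  rewrite -/(leib_action Pi alpha f x) -fxE; ring.
(* In other words, the zero tensor is the modular tensor of [mu]. *)
have key alpha : is_form alpha -> forall e, frames e -> forall x, fdom e x ->
    forall v : 'I_r -> A x, lie (sharp_sect Pi alpha) (trivialized mu e) v
      + nambu_div Pi alpha x * trivialized mu e v = 0.
  move=> aF e eF x ex v.
  exact: (modular_form_eq0 PiM (frame_open eF) (trivialized_form muD eF) ex gen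
    (fun f fS => muI f fS e eF x ex v) m0 aF).
apply/seteqP; split=> c.
  move=> [nu [T [nuD [_ nuT] [cC [f fS fE]]]]]; split => //.
  have [h [hS h0 hE]] := density_ratio muD nuD.
  have lnS : smooth (fun x => ln `|h x|).
    by apply: (smooth_on_log 0%N openT).
  (* [f] accounts for the passage from [c] to the cocycle of [nu], whose value on [alpha] is
     [X_alpha(h) / h], the derivative of [ln |h|]. *)
  exists (fun x => f x + ln `|h x|); first exact: smooth_onD openT fS lnS.
  move=> alpha aF x; rewrite subr0 /leib_action.
  have fN := smooth_smooth_near x fS; have lnN := smooth_smooth_near x lnS.
  have hN := smooth_smooth_near x hS.
  rewrite (tangentD (anchor_tangent _)) // -/(leib_action Pi alpha f x) -fE //.
  rewrite -[LHS](subrK (tensor_cochain T alpha x)); congr (_ + _).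
  have lnD := log_family_derive 0%N (h0 x).
  rewrite (tangent_comp (anchor_tangent _) hN lnN lnD) /= mul1r mul0r addr0 expr1.
  have [e eF ex] := frame_cover A x; have eB := frame_basis eF ex.
  have muF := trivialized_form muD eF; have eo := frame_open eF.
  have XS : smooth_sect (sharp_sect Pi alpha) by exact: sharp_smooth.
  have := nuT alpha aF e eF x ex (tnth (e x)).
  have nuE y (u : 'I_r -> A y) : fdom e y ->
      trivialized nu e u = h y * trivialized mu e u.
    by move=> ey; exact: hE (frame_basis eF ey) u.
  rewrite (_ : lie (sharp_sect Pi alpha) (trivialized nu e) (tnth (e x))
    = h x * lie (sharp_sect Pi alpha) (trivialized mu e) (tnth (e x))
      + anchor (sharp_sect Pi alpha x) h * trivialized mu e (tnth (e x))).
    rewrite nuE //.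
  have mu0 : trivialized mu e (tnth (e x)) != 0 by exact: density_frame_neq0.
  have := key alpha aF e eF x ex (tnth (e x)).
  set w := trivialized mu e _ in mu0 *; set L := lie _ _ _; set D := nambu_div _ _ _.
  set Y := anchor _ _; rewrite /tensor_cochain; set C := contract _ _.
  move=> LD CE; apply: (mulIf (mulf_neq0 (h0 x) mu0)).
  rewrite CE (_ : _^-1 * Y * (h x * w) = Y * w); last by field; exact: h0.
  have -> : L = - (D * w) by apply/eqP; rewrite -addr_eq0; apply/eqP.
  ring.
  (* The product rule left open above: [nu] agrees with [h mu] over the domain of [e], which
     suffices by [lie_congr]. *)
  rewrite -(lie_topM eo muF _ ex hS XS).
  apply: (lie_congr _ eo (trivialized_form nuD eF)
    (trivialized_form (density_scale muD hS h0) eF) ex XS) => y ey u.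
  exact: nuE.
(* For the other inclusion, [mu] with the zero tensor represents the modular class. *)
move=> [cC [f fS fE]]; exists mu, (fun _ _ => 0); split => //.
  split.
    split=> [x|xi xiS]; last exact/smooth_on_cst/openT.
    by split=> // *; rewrite mulr0 addr0.
  move=> alpha aF e eF x ex v; rewrite key // /contract big1 ?mul0r // => I _.
  by rewrite mulr0.
split => //; exists f => // alpha aF x; rewrite -fE //; congr (_ - _).
by rewrite /tensor_cochain /contract big1 // => I _; rewrite mulr0.
Qed.
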